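(* Let $X$ be a real Banach space, $k\in\mathbb{Z}^+$ and $1<p<\infty$. Then the following statements are equivalent. (1) $X$ is WUR (respectively, WLUR, WMLUR). (2) $\ell_p(X)$ is WUR (respectively, WLUR, WMLUR). (3) $\ell_p(X)$ is $k$-WUR (respectively, $k$-WLUR, $k$-WMLUR).
   Context: $\ell_p(X)$ is the space of sequences $(x_i)_{i\in\mathbb{N}}$ in $X$ with $\|(x_i)\|=(\sum_i\|x_i\|^p)^{1/p}<\infty$. The claim comprises three separate equivalences, one for each of the notions WUR, WLUR, WMLUR. For a Banach space $Z$ with unit sphere $S_Z$ and dual $Z^*$, $z_1,\dots,z_{k+1}\in Z$ and $f_1,\dots,f_k\in Z^*$, $D_k[(z_i)_{i=1}^{k+1};(f_j)_{j=1}^{k}]$ denotes the determinant of the $(k+1)\times(k+1)$ matrix whose first row consists of ones and whose $(j+1,i)$ entry is $f_j(z_i)$. $Z$ is $k$-WUR ($k$-weakly uniformly rotund) if for every $\epsilon>0$ and $f_1,\dots,f_k\in S_{Z^*}$, $$\inf\Big(\{1\}\cup\Big\{1-\tfrac{1}{k+1}\Big\|\sum_{i=1}^{k+1}z_i\Big\| : z_1,\dots,z_{k+1}\in S_Z,\ |D_k[(z_i)_{i=1}^{k+1};(f_j)_{j=1}^{k}]|\ge\epsilon\Big\}\Big)>0.$$ $Z$ is $k$-WLUR ($k$-weakly locally uniformly rotund) if for every $z\in S_Z$, $\epsilon>0$ and $f_1,\dots,f_k\in S_{Z^*}$, $$\inf\Big(\{1\}\cup\Big\{1-\tfrac{1}{k+1}\Big\|z+\sum_{i=1}^{k}z_i\Big\|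 : z_1,\dots,z_{k}\in S_Z,\ |D_k[z,(z_i)_{i=1}^{k};(f_j)_{j=1}^{k}]|\ge\epsilon\Big\}\Big)>0.$$ $Z$ is $k$-WMLUR ($k$-weakly midpoint locally uniformly rotund) if for any $z\in S_Z$ and any sequences $(z_n^{(1)}),\dots,(z_n^{(k+1)})$ in $S_Z$ with $\|(k+1)z-\sum_{i=1}^{k+1}z_n^{(i)}\|\to0$, it follows that $D_k[(z_n^{(i)})_{i=1}^{k+1};(f_j)_{j=1}^{k}]\to0$ for all $f_1,\dots,f_k\in S_{Z^*}$. WUR, WLUR, WMLUR mean $1$-WUR, $1$-WLUR, $1$-WMLUR. *)

(* Defs.v *)
From HB Require Import structures.
From mathcomp Require Import all_boot all_order all_algebra.
From mathcomp Require Import all_classical all_reals all_analysis.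

Set Implicit Arguments.
Unset Strict Implicit.
Unset Printing Implicit Defensive.

Import Order.TTheory GRing.Theory Num.Theory.
Import numFieldNormedType.Exports.

Local Open Scope classical_set_scope.
Local Open Scope ring_scope.

Section LpEnorm.
Context {R : realType} {X : normedModType R}.
Implicit Types (p : R) (x y : nat -> X).

(* +oo when x is not p-summable *)
Definition lp_enorm p x : \bar R :=
  ((\sum_(0 <= i <oo) (`|x i| `^ p)%:E) `^ p^-1)%E.

Lemma lp_enormE p x : 0 < p ->
  lp_enorm p x = 'N[counting]_p%:E[EFin \o (fun i => `|x i|%R)]%E.
Proof.
move=> p0; rewrite Lnorm_counting// /lp_enorm; congr (_ `^ _)%E.
by apply: eq_eseriesr => i _ /=; rewrite normr_id.
Qed.

Lemma lp_enorm_ge0 p x : (0 <= lp_enorm p x)%E.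
Proof. exact: poweR_ge0. Qed.

Lemma lp_sum_ge0 p x : (0 <= \sum_(0 <= i <oo) (`|x i| `^ p)%:E)%E.
Proof. by apply: nneseries_ge0 => n _ _; rewrite lee_fin powR_ge0. Qed.

Lemma lp_enorm_powR p x : 0 < p ->
  (lp_enorm p x `^ p = \sum_(0 <= i <oo) (`|x i| `^ p)%:E)%E.
Proof.
move=> p0; rewrite /lp_enorm -poweRrM mulVf ?gt_eqF// poweRe1//.
exact: lp_sum_ge0.
Qed.

Lemma le_lp_enorm p x y : 0 < p -> (forall i, `|x i| <= `|y i|) ->
  (lp_enorm p x <= lp_enorm p y)%E.
Proof.
move=> p0 xy; apply: gt0_ler_poweR.
- by rewrite invr_ge0 ltW.
- by rewrite in_itv/= leey lp_sum_ge0.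
- by rewrite in_itv/= leey lp_sum_ge0.
apply: lee_nneseries => i *; first by rewrite lee_fin powR_ge0.
by rewrite lee_fin; apply: ge0_ler_powR; rewrite ?nnegrE ?(ltW p0).
Qed.

Lemma lp_enorm0 p : 0 < p -> lp_enorm p (0 : nat -> X) = 0%E.
Proof.
move=> p0; rewrite /lp_enorm eseries0 ?poweR0r ?invr_eq0 ?gt_eqF//.
by move=> i _ _; rewrite normr0 powR0// gt_eqF.
Qed.

Lemma lp_enormD p x y : 1 <= p ->
  (lp_enorm p (x + y)%R <= lp_enorm p x + lp_enorm p y)%E.
Proof.
move=> p1; have p0 : 0 < p := lt_le_trans ltr01 p1.
pose nn (z : nat -> X) := fun i => `|z i|.
have mn z : measurable_fun [set: nat] (nn z) by [].
rewrite !lp_enormE//.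
apply: le_trans (minkowski_EFin counting (mn x) (mn y) p1).
rewrite !Lnorm_counting//; apply: gt0_ler_poweR.
- by rewrite invr_ge0 ltW.
- by rewrite in_itv/= leey nneseries_ge0// => n _ _; rewrite lee_fin powR_ge0.
- by rewrite in_itv/= leey nneseries_ge0// => n _ _; rewrite lee_fin powR_ge0.
apply: lee_nneseries => i *; first by rewrite lee_fin powR_ge0.
rewrite lee_fin; apply: ge0_ler_powR; rewrite ?nnegrE ?(ltW p0)//=.
by rewrite normr_id [leRHS]ger0_norm ?addr_ge0 ?normr_ge0 ?ler_normD// addr_ge0 ?normr_ge0.
Qed.

Lemma lp_enormZ p (a : R) x : 0 < p ->
  lp_enorm p (a *: x) = (`|a|%:E * lp_enorm p x)%E.
Proof.
move=> p0; rewrite /lp_enorm.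
under eq_eseriesr do rewrite normrZ powRM// EFinM.
rewrite nneseriesZl; last by move=> i _; rewrite lee_fin powR_ge0.
rewrite poweRM ?lee_fin ?powR_ge0 ?lp_sum_ge0//.
by rewrite poweR_EFin -powRrM mulfV ?gt_eqF// powRr1.
Qed.

Lemma lp_enorm_coord p x i : 0 < p -> (`|x i|%:E <= lp_enorm p x)%E.
Proof.
move=> p0; have -> : `|x i|%:E = ((`|x i| `^ p)%:E `^ p^-1)%E.
  by rewrite poweR_EFin -powRrM mulfV ?gt_eqF// powRr1.
apply: gt0_ler_poweR.
- by rewrite invr_ge0 ltW.
- by rewrite in_itv/= leey lee_fin powR_ge0.
- by rewrite in_itv/= leey lp_sum_ge0.
have u0 j : (0 <= j)%N -> true -> (0 <= (`|x j| `^ p)%:E)%E.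
  by move=> _ _; rewrite lee_fin powR_ge0.
apply: (le_trans _ (nneseries_lim_ge i.+1 u0)).
by rewrite big_nat_recr//= leeDr// sume_ge0// => j _; exact: u0.
Qed.

Lemma lp_enorm_le p x (c : R) : 0 < p -> 0 <= c ->
  (forall n, \sum_(0 <= i < n) `|x i| `^ p <= c `^ p) ->
  (lp_enorm p x <= c%:E)%E.
Proof.
move=> p0 c0 xc; have -> : c%:E = ((c `^ p)%:E `^ p^-1)%E.
  by rewrite poweR_EFin -powRrM mulfV ?gt_eqF// powRr1.
apply: gt0_ler_poweR.
- by rewrite invr_ge0 ltW.
- by rewrite in_itv/= leey lp_sum_ge0.
- by rewrite in_itv/= leey lee_fin powR_ge0.
apply: lime_le.
  by apply: is_cvg_nneseries => n _ _; rewrite lee_fin powR_ge0.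
by apply: nearW => n; rewrite sumEFin lee_fin.
Qed.

Lemma lp_enorm_ge p x (c : R) n : 0 < p -> 0 <= c ->
  (lp_enorm p x <= c%:E)%E -> \sum_(0 <= i < n) `|x i| `^ p <= c `^ p.
Proof.
move=> p0 c0 xc; rewrite -lee_fin -sumEFin.
have u0 j : (0 <= j)%N -> true -> (0 <= (`|x j| `^ p)%:E)%E.
  by move=> _ _; rewrite lee_fin powR_ge0.
apply: (le_trans (nneseries_lim_ge n u0)).
rewrite -lp_enorm_powR// -poweR_EFin; apply: gt0_ler_poweR => //.
- exact: ltW.
- by rewrite in_itv/= leey lp_enorm_ge0.
- by rewrite in_itv/= leey lee_fin andbT.
Qed.

End LpEnorm.

Section LpSpace.
Context {R : realType} {p : R} (p1 : 1 <= p) (X : normedModType R).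

Let p0 : 0 < p. Proof. exact: lt_le_trans p1. Qed.

(* The unused argument [1 <= p] lets instance resolution find the closure
   properties, which hold only for such p. *)
Definition lp_pred of 1 <= p : {pred (nat -> X)} :=
  mem [set x : nat -> X | (lp_enorm p x < +oo)%E].

Lemma lp_predP x : reflect (lp_enorm p x < +oo)%E (x \in lp_pred p1).
Proof. by apply: (iffP idP); rewrite inE. Qed.

Lemma lp_submod_closed : submod_closed (lp_pred p1).
Proof.
split=> [|a x y /lp_predP xoo /lp_predP yoo]; apply/lp_predP.
  by rewrite lp_enorm0.
apply: le_lt_trans (lp_enormD _ _ p1) _; rewrite lte_add_pinfty//.
by rewrite lp_enormZ// lte_mul_pinfty ?lee_fin.
Qed.

HB.instance Definition _ := GRing.isSubmodClosed.Build _ _ (lp_pred p1)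
  lp_submod_closed.

Record lpspace := LpSpace {
  lp_fun :> nat -> X ;
  lp_funP : lp_fun \in lp_pred p1 }.

HB.instance Definition _ := [isSub for lp_fun].
HB.instance Definition _ := [Choice of lpspace by <:].
HB.instance Definition _ := [SubChoice_isSubLmodule of lpspace by <:].

Definition lp_norm (x : lpspace) : R := fine (lp_enorm p x).

Lemma lp_normE x : (lp_norm x)%:E = lp_enorm p x.
Proof.
by rewrite fineK// ge0_fin_numE ?lp_enorm_ge0//; apply/lp_predP/lp_funP.
Qed.

Lemma lp_normD x y : lp_norm (x + y) <= lp_norm x + lp_norm y.
Proof. by rewrite -lee_fin EFinD !lp_normE; exact: lp_enormD. Qed.

Lemma lp_normZ (a : R) x : lp_norm (a *: x) = `|a| * lp_norm x.
Proof. by apply: EFin_inj; rewrite EFinM !lp_normE -lp_enormZ. Qed.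

Lemma lp_norm_eq0 x : lp_norm x = 0 -> x = 0.
Proof.
move=> x0; apply/val_inj/funext => i /=.
apply/normr0_eq0/le_anti; rewrite normr_ge0 andbT -lee_fin.
by rewrite -x0 lp_normE lp_enorm_coord.
Qed.

HB.instance Definition _ :=
  Lmodule_isNormed.Build R lpspace lp_normD lp_normZ lp_norm_eq0.

End LpSpace.

Section LpComplete.
Context {R : realType} {p : R} (p1 : 1 <= p) (X : completeNormedModType R).

Let p0 : 0 < p. Proof. exact: lt_le_trans p1. Qed.

Let continuous_norm_powR : continuous (fun t : X => `|t| `^ p).
Proof.
move=> t; have [->|t0] := eqVneq t 0.
  apply/cvgrPdist_lt => e e0; rewrite normr0 powR0 ?gt_eqF//.
  have d0 : 0 < e `^ p^-1 by exact: powR_gt0.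
  apply/nbhs_norm0P; exists (e `^ p^-1) => //= u /= ud; rewrite sub0r normrN ger0_norm ?powR_ge0//.
  rewrite -[e]powRr1 ?ltW// -(mulVf (lt0r_neq0 p0)) powRrM.
  by apply: gt0_ltr_powR; rewrite ?nnegrE ?powR_ge0.
have := @derivable_powR R 1 p `|t|.
rewrite in_itv/= andbT normr_gt0 => /(_ t0) /derivable1_diffP.
move=> /differentiable_continuous cp.
apply: (@continuous_comp _ _ _ (fun t : X => `|t|) (fun a : R => a `^ p)) => //.
exact: norm_continuous.
Qed.

Lemma lp_normr (x : lpspace p1 X) : `|x| = lp_norm x.
Proof. by []. Qed.

Lemma lp_norm_coord (x : lpspace p1 X) i : `|x i| <= `|x|.
Proof. by rewrite lp_normr -lee_fin lp_normE lp_enorm_coord. Qed.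

Lemma lp_complete (F : set_system (lpspace p1 X)) :
  ProperFilter F -> cauchy F -> cvg F.
Proof.
move=> FF /cauchy_ballP Fc.
have cF i : cvg ((fun x : lpspace p1 X => x i) @ F).
  apply: cauchy_cvg; apply/cauchy_ballP => e e0.
  have [[A B]/= [FA FB] AB] := Fc e e0.
  exists ([set t | exists2 x, A x & x i = t], [set t | exists2 x, B x & x i = t]).
    by split => /=; [apply: filterS FA | apply: filterS FB] => x ?; exists x.
  move=> [_ _] [/= [x Ax <-] [z Bz <-]].
  have := AB (x, z) (conj Ax Bz); rewrite -!ball_normE/=; apply: le_lt_trans.
  exact: (lp_norm_coord (x - z) i).
pose y i := lim ((fun x : lpspace p1 X => x i) @ F).
have key (e : R) : 0 < e -> \forall x \near F, (lp_enorm p (fun i => (x : lpspace p1 X) i - y i)%R <= e%:E)%E.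
  move=> e0.
  have Fe : \forall x \near F & z \near F, ball (x : lpspace p1 X) e z.
    exact: Fc.
  move/nearP_dep in Fe; apply: filterS Fe => x Fx.
  apply: lp_enorm_le => //; first exact: ltW.
  move=> n; apply: (@cvgr_to_le _ F _ _
     (fun z : lpspace p1 X => \sum_(0 <= i < n) `|x i - z i| `^ p)).
    apply: cvg_big => [|i _]; first exact: add_continuous.
    apply: (@cvg_comp _ _ _ (fun z : lpspace p1 X => x i - z i)
        (fun t => `|t| `^ p) F (nbhs (x i - y i))); last exact: continuous_norm_powR.
    by apply: cvgB; [exact: cvg_cst|exact: cF].
  apply: filterS Fx => z; rewrite -ball_normE/= => xz.
  apply: (lp_enorm_ge (x := x - z)) => //; first exact: ltW.
  by rewrite -lp_normE lee_fin ltW.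
have /filter_ex[x0 xy] := key 1 ltr01.
have yP : y \in lp_pred p1.
  have -> : y = (x0 : nat -> X) - (fun i => x0 i - y i).
    by apply/funext => i; rewrite /= opprB addrC subrK.
  rewrite rpredB//; first exact: lp_funP.
  by apply/lp_predP; rewrite (le_lt_trans xy) ?ltry.
apply/cvg_ex; exists (LpSpace yP); apply/cvgrPdist_le => e e0.
apply: filterS (key e e0) => x xe.
by rewrite distrC -lee_fin lp_normr lp_normE.
Qed.

HB.instance Definition _ :=
  Uniform_isComplete.Build (lpspace p1 X) lp_complete.

End LpComplete.

Section Rotundity.
Context {R : realType}.
Implicit Types (Z : completeNormedModType R) (k : nat).

Definition unit_sphere Z : set Z := [set z | `|z| = 1].

Definition dual_norm Z (f : {linear Z -> R^o}) : R :=
  sup [set `|f z : R| | z in [set z : Z | `|z| <= 1]].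

Definition dual_unit_sphere Z : set {linear Z -> R^o} :=
  [set f : {linear Z -> R^o} | continuous f /\ dual_norm f = 1].

Definition Ddet k Z (z : 'I_k.+1 -> Z) (f : 'I_k -> {linear Z -> R^o}) : R :=
  \det (\matrix_(r < k.+1, i < k.+1)
    if unlift ord0 r is Some j then f j (z i) : R else 1).

(* the family (z0, z 0, ..., z (k - 1)) *)
Definition ord_cons k Z (z0 : Z) (z : 'I_k -> Z) : 'I_k.+1 -> Z :=
  fun i => if unlift ord0 i is Some j then z j else z0.

Definition kWUR k Z : Prop :=
  forall (eps : R) (f : 'I_k -> {linear Z -> R^o}),
    0 < eps -> (forall j, dual_unit_sphere (f j)) ->
    0 < inf ([set 1] `|`
      [set 1 - k.+1%:R^-1 * `|\sum_(i < k.+1) z i| |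
         z in [set z : 'I_k.+1 -> Z |
           (forall i, unit_sphere (z i)) /\ eps <= `|Ddet z f|]]).

Definition kWLUR k Z : Prop :=
  forall (z0 : Z) (eps : R) (f : 'I_k -> {linear Z -> R^o}),
    unit_sphere z0 -> 0 < eps -> (forall j, dual_unit_sphere (f j)) ->
    0 < inf ([set 1] `|`
      [set 1 - k.+1%:R^-1 * `|z0 + \sum_(i < k) z i| |
         z in [set z : 'I_k -> Z |
           (forall i, unit_sphere (z i)) /\
           eps <= `|Ddet (ord_cons z0 z) f|]]).

Definition kWMLUR k Z : Prop :=
  forall (z0 : Z) (z : 'I_k.+1 -> nat -> Z),
    unit_sphere z0 -> (forall i n, unit_sphere (z i n)) ->
    `|k.+1%:R *: z0 - \sum_(i < k.+1) z i n| @[n --> \oo] --> (0 : R) ->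
    forall f : 'I_k -> {linear Z -> R^o},
      (forall j, dual_unit_sphere (f j)) ->
      Ddet (fun i => z i n) f @[n --> \oo] --> (0 : R).

Definition WUR Z : Prop := kWUR 1 Z.
Definition WLUR Z : Prop := kWLUR 1 Z.
Definition WMLUR Z : Prop := kWMLUR 1 Z.

End Rotundity.

(* Main.v *)
(** For a pair of unit vectors [u], [v] with [|u + v|] close to [2], each of the
    three notions asks that [f (u - v)] be small, under a side condition on
    [u], [v] depending on the notion.  Averages of [k + 1] unit vectors reduce
    to such pairs, which gives WUR => k-WUR and its analogues.

    For [X => lp X], the quantity [(|u|^p + |v|^p) / 2 - |(u + v) / 2|^p] is
    nonnegative and additive over coordinates, so when it is small in [lp X] it
    is small in every coordinate; since the tails of a functional on [lp X] tend
    to zero in norm, only finitely many coordinates matter.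

    For [k-WUR (lp X) => X], place a bad pair [u], [w] of [X] into the [k + 1]
    vectors of [k] equal blocks that are constantly [w], respectively [w] with
    one block replaced by [u]: their determinant is a power of a multiple of
    [f (u - w)]. *)
Require Import Defs.
From HB Require Import structures.
From mathcomp Require Import all_boot all_order all_algebra.
From mathcomp Require Import all_classical all_reals all_analysis.
From mathcomp Require Import perm.
From mathcomp Require Import ring lra.

Set Implicit Arguments.
Unset Strict Implicit.
Unset Printing Implicit Defensive.

Import Order.TTheory GRing.Theory Num.Theory.
Import numFieldNormedType.Exports.

Local Open Scope ring_scope.

(** * Convexity and superadditivity estimates for real powers *)

Section PowerInequalities.
Variables (R : realType) (p : R) (p1 : 1 < p).

Let p0 : 0 < p. Proof. exact: lt_trans p1. Qed.

Lemma ltr_powR_tangent (t : R) : 0 <= t -> t != 1 -> 1 + p * (t - 1) < t `^ p.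
Proof.
rewrite le_eqVlt => /predU1P[<- _|t0 tn1].
  by rewrite powR0 ?gt_eqF// sub0r mulrN1 subr_lt0.
pose s := ln t.
have sE : t = expR s by rewrite lnK// posrE.
have sn0 : s != 0 by rewrite ln_eq0.
have tpE : t `^ p = expR (p * s) by rewrite /powR gt_eqF.
(* Both [exp (p s)] and [exp 0] lie strictly above the tangent to [exp] at [s],
   and [s] is their barycentre with weights [1 / p] and [1 - 1 / p]. *)
have e1 : 1 + (p * s - s) < expR (p * s - s).
  by apply: expR_gt1Dx; rewrite -{2}[s]mul1r -mulrBl mulf_neq0// subr_eq0 gt_eqF.
have e2 : 1 - s < expR (- s) by apply: expR_gt1Dx; rewrite oppr_eq0.
rewrite expRD in e1.
have e3 : expR s * (1 + (p * s - s)) < expR (p * s).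
  by rewrite -ltr_pdivlMl ?expR_gt0// -expRN [ltRHS]mulrC.
have e4 : expR s * (1 - s) < 1.
  by rewrite -ltr_pdivlMl ?expR_gt0// mulr1 -expRN.
have e5 : 0 < (p - 1) * (1 - expR s * (1 - s)) by rewrite mulr_gt0// subr_gt0.
rewrite tpE sE; lra.
Qed.

Lemma ler_powR_tangent (t : R) : 0 <= t -> 1 + p * (t - 1) <= t `^ p.
Proof.
move=> t0; have [->|tn1] := eqVneq t 1; last exact/ltW/ltr_powR_tangent.
by rewrite powR1 subrr mulr0 addr0.
Qed.

(** Factor each power of [c] as [c] times its [(p - 1)]-th power, and use that the latter is
    nondecreasing in [c]. *)
Lemma powRDge (a b : R) : 0 <= a -> 0 <= b -> a `^ p + b `^ p <= (a + b) `^ p.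
Proof.
move=> a0 b0.
have le (c : R) : 0 <= c -> c <= a + b -> c `^ (p - 1) <= (a + b) `^ (p - 1).
  by move=> c0 cab; rewrite ge0_ler_powR ?nnegrE ?subr_ge0 ?(ltW p1)// addr_ge0.
rewrite -(mulr_powRB1 a0 p0) -(mulr_powRB1 b0 p0).
rewrite -(mulr_powRB1 (addr_ge0 a0 b0) p0) mulrDl.
by rewrite lerD// ler_wpM2l// le// ?lerDl ?lerDr.
Qed.

Lemma powR_midpoint_gap_pos (r0 : R) : 0 < r0 ->
  0 < (1 + r0) `^ p - 1 - p * r0.
Proof.
move=> r00; have H := @ltr_powR_tangent (1 + r0); rewrite [1 + r0 - 1]addrC addKr in H.
have : 1 + p * r0 < (1 + r0) `^ p by apply: H; lra.
lra.
Qed.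

(** The tangent at [1] bounds the power of [1 - r] below, and the tangent at [1 + r0], whose slope
    is at least [p], that of [1 + r]. In the sum the terms in [r] cancel. *)
Lemma powR_midpoint_gap (r0 r : R) : 0 < r0 -> r0 <= r -> r <= 1 ->
  1 + ((1 + r0) `^ p - 1 - p * r0) / 2 <= ((1 + r) `^ p + (1 - r) `^ p) / 2.
Proof.
move=> r00 r0r r1.
have H1 : 1 - p * r <= (1 - r) `^ p.
  have := @ler_powR_tangent (1 - r); rewrite subr_ge0 => /(_ r1).
  by rewrite [1 - r - 1]addrC addKr mulrN.
have H2 : (1 + r0) `^ p + p * (r - r0) <= (1 + r) `^ p.
  have q0 : 0 < 1 + r0 by lra.
  pose t := (1 + r) / (1 + r0).
  have t0 : 0 <= t by rewrite divr_ge0//; lra.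
  have -> : 1 + r = (1 + r0) * t by rewrite /t mulrCA mulfV ?mulr1// gt_eqF.
  rewrite powRM ?(ltW q0)//.
  have Ht := ler_powR_tangent t0.
  have Hq : 1 + r0 <= (1 + r0) `^ p.
    by rewrite le1r_powR ?ltW//; lra.
  have tE : (1 + r0) * (t - 1) = r - r0.
    by rewrite /t mulrBr mulr1 mulrCA mulfV ?gt_eqF// mulr1; lra.
  have t1 : 0 <= t - 1 by rewrite -(pmulr_rge0 _ q0) tE subr_ge0.
  have : (1 + r0) `^ p * (1 + p * (t - 1)) <= (1 + r0) `^ p * t `^ p.
    by rewrite ler_wpM2l ?powR_ge0.
  have : p * ((1 + r0) * (t - 1)) <= p * ((1 + r0) `^ p * (t - 1)).
    by rewrite ler_pM2l// ler_wpM2r.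
  rewrite tE; lra.
lra.
Qed.

(** After division by the mean [m], the tangents at [1] to the two powers have linear parts that
    cancel. *)
Lemma powR_midpoint (a b : R) : 0 <= a -> 0 <= b ->
  ((a + b) / 2) `^ p <= (a `^ p + b `^ p) / 2.
Proof.
move=> a0 b0; set m := (a + b) / 2.
have m0 : 0 <= m by rewrite /m; lra.
have [mz|mn0] := eqVneq m 0.
  by rewrite mz powR0 ?gt_eqF// divr_ge0 ?addr_ge0 ?powR_ge0.
have mgt0 : 0 < m by rewrite lt_neqAle eq_sym mn0.
have E (c : R) : 0 <= c -> c `^ p = m `^ p * (c / m) `^ p.
  by move=> c0; rewrite -(powRM _ m0 (divr_ge0 c0 m0)) mulrCA mulfV ?mulr1.
rewrite (E a)// (E b)//.
have Ha := ler_powR_tangent (divr_ge0 a0 m0).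
have Hb := ler_powR_tangent (divr_ge0 b0 m0).
have Hs : a / m + b / m = 2.
  by rewrite -mulrDl -[a + b](@divfK _ 2)// -/m mulrAC mulfV// mul1r.
have : m `^ p * 2 <= m `^ p * ((a / m) `^ p + (b / m) `^ p).
  rewrite ler_wpM2l ?powR_ge0//.
  have : p * (a / m + b / m) = p * 2 by rewrite Hs.
  rewrite mulrDr; lra.
lra.
Qed.

(** Meant for the norms [a], [b], [c] of coordinates [u i], [v i], [u i + v i]. The gap is the
    convexity gap of [a], [b] plus the drop of the power from [(a + b) / 2] to [c / 2]. Both are
    nonnegative; the first controls [a - b], the second [a + b - c]. *)
Lemma powR_midpoint_uniform (eta : R) : 0 < eta ->
  exists2 d : R, 0 < d & forall a b c : R,
    0 <= a -> a <= 1 -> 0 <= b -> b <= 1 -> 0 <= c -> c <= a + b ->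
    (a `^ p + b `^ p) / 2 - (c / 2) `^ p < d ->
    `|a - b| < eta /\ a + b - c < eta.
Proof.
move=> eta0.
pose r0 := eta / 2; have r00 : 0 < r0 by rewrite /r0; lra.
pose g := (1 + r0) `^ p - 1 - p * r0.
have g0 : 0 < g by exact: powR_midpoint_gap_pos.
have e0 : 0 < r0 `^ p by exact: powR_gt0.
have sym (a b : R) : 0 <= b -> b <= a -> a <= 1 ->
    (a `^ p + b `^ p) / 2 - ((a + b) / 2) `^ p < r0 `^ p * (g / 2) ->
    a - b < eta.
  move=> b0 ba a1; apply: contraTT; rewrite -!leNgt => abe.
  (* Normalised by the mean, the pair is [1 + r], [1 - r]. Since [a - b >= eta] and [b >= 0],
     [m >= r0], which gives the factor [r0 ^ p] in the bound; since [m <= 1], also [r >= r0]. *)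
  pose m := (a + b) / 2; pose r := (a - b) / 2 / m.
  have m0 : 0 < m by rewrite /m; lra.
  have rm : r * m = (a - b) / 2 by rewrite /r divfK// gt_eqF.
  have r1 : r <= 1 by rewrite /r ler_pdivrMr// mul1r /m; lra.
  have m1 : m <= 1 by rewrite /m; lra.
  have rr0 : r0 <= r.
    rewrite /r ler_pdivlMr//; apply: (@le_trans _ _ (r0 * 1)); last by rewrite /r0; lra.
    by rewrite ler_wpM2l// ltW.
  have aE : a = m * (1 + r) by rewrite mulrDr mulr1 (mulrC m) rm /m; lra.
  have bE : b = m * (1 - r) by rewrite mulrBr mulr1 (mulrC m) rm /m; lra.
  have H := powR_midpoint_gap r00 rr0 r1.
  have apE : a `^ p = m `^ p * (1 + r) `^ p by rewrite {1}aE powRM ?(ltW m0)//; lra.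
  have bpE : b `^ p = m `^ p * (1 - r) `^ p by rewrite {1}bE powRM ?(ltW m0)//; lra.
  rewrite -/m apE bpE.
  have Hm : r0 `^ p <= m `^ p.
    by rewrite ge0_ler_powR ?nnegrE ?(ltW p0) ?(ltW r00) ?(ltW m0)// /r0 /m; lra.
  have : r0 `^ p * (g / 2) <= m `^ p * (g / 2) by rewrite ler_wpM2r// divr_ge0 ?ltW.
  have : m `^ p * (1 + g / 2) <= m `^ p * (((1 + r) `^ p + (1 - r) `^ p) / 2).
    by rewrite ler_wpM2l ?powR_ge0.
  lra.
exists (Num.min (r0 `^ p * (g / 2)) (r0 `^ p)).
  by rewrite lt_min e0 mulr_gt0 ?divr_gt0.
move=> a b c a0 a1 b0 b1 c0 cab; rewrite lt_min => /andP[H1 H2].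
have cm : (c / 2) `^ p <= ((a + b) / 2) `^ p.
  by rewrite ge0_ler_powR ?nnegrE ?(ltW p0)//; lra.
split.
  have [ba|ab] := leP b a.
    rewrite ger0_norm ?subr_ge0//; apply: sym => //; lra.
  rewrite ltr0_norm ?subr_lt0// opprB; apply: sym => //; first lra.
  rewrite (addrC (b `^ p)) (addrC b); lra.
(* If [a + b - c >= eta], then [c / 2 + r0 <= (a + b) / 2], and superadditivity makes the gap at
   least [r0 ^ p]. *)
rewrite ltNge; apply/negP => Hc.
have := @powRDge (c / 2) r0; have := powR_midpoint a0 b0.
have : (c / 2 + r0) `^ p <= ((a + b) / 2) `^ p.
  by rewrite ge0_ler_powR ?nnegrE ?(ltW p0)// /r0; lra.
move=> A B C; have {}C : (c / 2) `^ p + r0 `^ p <= (c / 2 + r0) `^ p by apply: C; lra.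
lra.
Qed.

End PowerInequalities.

(** * Bounded functionals and the dual norm *)

Section Functionals.
Context {R : realType} {Z : completeNormedModType R}.
Implicit Types f : {linear Z -> R^o}.

Lemma linear_continuous_of_bound f (M : R) :
  (forall z, `|f z : R| <= M * `|z|) -> continuous f.
Proof.
move=> fM; apply: bounded_linear_continuous; apply/linear_boundedP.
exists M; split; first exact: num_real.
by move=> r Mr z; rewrite (le_trans (fM z))// ler_wpM2r// ltW.
Qed.

Lemma dual_norm_has_sup f : continuous f ->
  has_sup [set `|f z : R| | z in [set z : Z | `|z| <= 1]].
Proof.
move=> fc; split.
  by exists `|f 0 : R|, 0 => //=; rewrite normr0.
have /linear_boundedP[M [_ fM]] :=
  @continuous_linear_bounded R Z R^o 0 f (fc 0).
exists (`|M| + 1) => _ [z /= z1 <-].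
have Mlt : M < `|M| + 1 by rewrite (le_lt_trans (ler_norm M))// ltrDl.
apply: le_trans (fM _ Mlt z) _.
by rewrite ler_piMr// addr_ge0.
Qed.

Lemma dual_norm_ge f z : continuous f -> `|z| <= 1 -> `|f z : R| <= dual_norm f.
Proof.
move=> fc z1; apply: ub_le_sup; last by exists z.
by have [] := dual_norm_has_sup fc.
Qed.

Lemma dual_norm_ge0 f : continuous f -> 0 <= dual_norm f.
Proof.
by move=> fc; apply: le_trans (normr_ge0 _) (@dual_norm_ge f 0 fc _); rewrite normr0.
Qed.

Lemma normr_le_dual_norm f z : continuous f -> `|f z : R| <= dual_norm f * `|z|.
Proof.
move=> fc; have [->|z0] := eqVneq z 0; first by rewrite linear0 !normr0 mulr0.
have nz : 0 < `|z| by rewrite normr_gt0.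
have := @dual_norm_ge f (`|z|^-1 *: z) fc.
rewrite linearZ !normrZ /= normfV normr_id mulVf ?gt_eqF// => /(_ (lexx _)).
by rewrite ler_pdivrMl// mulrC.
Qed.

Lemma dual_unit_sphere_le f z : dual_unit_sphere f -> `|f z : R| <= `|z|.
Proof. by move=> [fc f1]; rewrite -[leRHS]mul1r -f1 normr_le_dual_norm. Qed.

Lemma functional_normB f x y : `|f (x - y) : R| <= `|f x : R| + `|f y : R|.
Proof. rewrite linearB; exact: (ler_normB (f x : R) (f y)). Qed.

End Functionals.

(** * Rotundity conditions on pairs and their homogeneous form *)

Section PairRotundity.
Context {R : realType}.
Implicit Types (al be : R) (Z : completeNormedModType R).

(* [(al, be)] is [(0, 0)] for WUR, [(1, 0)] for WLUR and [(1, 1)] for WMLUR. *)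
Definition unit_pair_rotund al be Z : Prop :=
  forall (f : {linear Z -> R^o}) (z : Z) (eps : R),
    dual_unit_sphere f -> 0 < eps -> exists2 d : R, 0 < d & forall u v : Z,
      `|u| = 1 -> `|v| = 1 -> 2 - d < `|u + v| ->
      `|al *: (u - z) + be *: (v - z)| < d -> `|f (u - v) : R| < eps.

(** The form that survives passing to coordinates of [lp], where vectors and functionals lose their
    norm one. The bound [2] leaves room for vectors of norm slightly above one. *)
Definition pair_rotund al be Z : Prop :=
  forall (f : {linear Z -> R^o}) (z : Z) (eps : R),
    continuous f -> 0 < eps -> exists2 d : R, 0 < d & forall u v : Z,
      `|u| <= 2 -> `| `|u| - `|v| | < d -> `|u| + `|v| - `|u + v| < d ->
      `|al *: (u - z) + be *: (v - z)| < d -> `|f (u - v) : R| < eps.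

(** Dividing [f] by its dual norm only rescales [eps]; if the dual norm is [0], so is [f]. *)
Lemma pair_rotund_of_unit_functional al be Z :
  (forall (f : {linear Z -> R^o}) (z : Z) (eps : R),
    dual_unit_sphere f -> 0 < eps -> exists2 d : R, 0 < d & forall u v : Z,
      `|u| <= 2 -> `| `|u| - `|v| | < d -> `|u| + `|v| - `|u + v| < d ->
      `|al *: (u - z) + be *: (v - z)| < d -> `|f (u - v) : R| < eps) ->
  pair_rotund al be Z.
Proof.
move=> H f z eps fc eps0.
have := dual_norm_ge0 fc; rewrite le_eqVlt => /predU1P[M0|M0].
  exists 1 => // u v _ _ _ _.
  by rewrite (le_lt_trans (normr_le_dual_norm _ fc))// -M0 mul0r.
set M := dual_norm f in M0.
pose g : {linear Z -> R^o} := M^-1 \*: f.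
have gE w : g w = M^-1 * f w by [].
have nE w : `|g w : R| = M^-1 * `|f w : R|.
  by rewrite gE normrM normfV (gtr0_norm M0).
have gle w : `|g w : R| <= 1 * `|w|.
  by rewrite nE ler_pdivrMl// mul1r normr_le_dual_norm.
have gc : continuous g by exact: linear_continuous_of_bound gle.
have gS : dual_unit_sphere g.
  split=> //; apply/eqP; rewrite eq_le; apply/andP; split.
    apply: ge_sup; first by have [] := dual_norm_has_sup gc.
    by move=> _ [w /= w1 <-]; rewrite (le_trans (gle _))// mul1r.
  rewrite -(mulVf (lt0r_neq0 M0)) ler_pdivrMl//.
  apply: ge_sup; first by have [] := dual_norm_has_sup fc.
  move=> _ [w /= w1 <-].
  by rewrite -ler_pdivrMl// -nE dual_norm_ge.
have eM : 0 < M^-1 * eps by rewrite mulr_gt0 ?invr_gt0.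
have [d d0 Hd] := H g z (M^-1 * eps) gS eM.
exists d => // u v u2 uv uv' uvz; have := Hd u v u2 uv uv' uvz.
by rewrite nE ltr_pM2l ?invr_gt0.
Qed.

(** Shows that [z] may be normalised together with [u]. The vector [w = al u + be v] has norm close
    to [(al + be) |u|]: above by the triangle inequality, below through
    [w = al (u + v) - (al - be) v]. It is also within [d] of [(al + be) z]. *)
Lemma norm_comb_eq al be Z (u v z : Z) (d : R) : 0 <= be -> be <= al -> al <= 1 ->
  `| `|u| - `|v| | < d -> `|u| + `|v| - `|u + v| < d ->
  `|al *: (u - z) + be *: (v - z)| < d ->
  (al + be) * `| `|z| - `|u| | <= 3 * d.
Proof.
move=> be0 beal al1; rewrite ltr_norml => /andP[h1 h2] h3 h4.
have d0 : 0 < d := le_lt_trans (normr_ge0 _) h4.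
set w := al *: u + be *: v.
have wz : al *: (u - z) + be *: (v - z) = w - (al + be) *: z.
  by rewrite !scalerBr scalerDl addrACA opprD.
have up : `|w| <= al * `|u| + be * `|v|.
  by apply: le_trans (ler_normD _ _) _; rewrite !normrZ !ger0_norm//; lra.
have lo : al * `|u + v| - (al - be) * `|v| <= `|w|.
  have -> : w = al *: (u + v) - (al - be) *: v.
    by rewrite scalerDr scalerBl opprB addrA addrAC addrK.
  apply: le_trans (lerB_dist _ _); rewrite !normrZ !ger0_norm//; lra.
have : `| `|w| - (al + be) * `|z| | <= `|w - (al + be) *: z|.
  apply: le_trans (ler_dist_dist _ _); rewrite normrZ ger0_norm//; lra.
rewrite -wz => /le_lt_trans/(_ h4); rewrite ltr_norml => /andP[k1 k2].
have ab0 : 0 <= al + be by lra.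
rewrite -{1}(ger0_norm ab0) -normrM mulrBr ler_norml.
have : al * (`|u| + `|v| - `|u + v|) <= al * d by rewrite ler_wpM2l//; lra.
have : be * (`|v| - `|u|) <= be * d by rewrite ler_wpM2l//; lra.
have : be * (`|u| - `|v|) <= be * d by rewrite ler_wpM2l//; lra.
have : be * d <= al * d by rewrite ler_wpM2r// ltW.
have : al * d <= 1 * d by rewrite ler_wpM2r// ltW.
move=> *; apply/andP; split; lra.
Qed.

(** If [|f (u - v)| >= eps], then [|u| + |v| >= eps], so both norms are bounded away from [0].
    Dividing [u], [v], [z] by their norms then changes every quantity by a multiple of [d / |u|]. *)
Lemma unit_pair_rotund_homogeneous al be Z : 0 <= be -> be <= al -> al <= 1 ->
  unit_pair_rotund al be Z -> pair_rotund al be Z.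
Proof.
move=> be0 beal al1 G; apply: pair_rotund_of_unit_functional => f z eps fS eps0.
pose zh := `|z|^-1 *: z.
have e4 : 0 < eps / 4 by rewrite divr_gt0.
have [d0 d00 Hd] := G f zh (eps / 4) fS e4.
pose a0 := eps / 4; have a00 : 0 < a0 by rewrite /a0; lra.
(* The first term gives [a0 <= |u|] and [v != 0]. The second makes [d / |u|] at most [d0 / 6],
   against a total error of five such terms in the side condition. The third bounds the error in the
   value of [f]. *)
pose d := Num.min (a0 / 2) (Num.min (d0 * a0 / 6) (eps / 8 * a0)).
have dle1 : d <= a0 / 2 by rewrite ge_min lexx.
have dle2 : d <= d0 * a0 / 6 by rewrite !ge_min lexx orbT.
have dle3 : d <= eps / 8 * a0 by rewrite !ge_min lexx !orbT.
have dgt0 : 0 < d by rewrite !lt_min !(divr_gt0, mulr_gt0).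
exists d => // u v u2 h1 h2 h3; rewrite ltNge; apply/negP => hf.
have hz := norm_comb_eq be0 beal al1 h1 h2 h3.
have /andP[h1a h1b] : - d < `|u| - `|v| < d by rewrite -ltr_norml.
have fB x : `|f x : R| <= `|x| := dual_unit_sphere_le x fS.
have huv : eps <= `|u| + `|v|.
  by rewrite (le_trans hf)// (le_trans (fB _))// (le_trans (ler_normB _ _)).
set a := `|u| in u2 h1 h2 hz h1a h1b huv.
set b := `|v| in h1 h2 h1a h1b huv.
have aa0 : a0 <= a by rewrite /a0 in dle1 a00 *; lra.
have agt0 : 0 < a := lt_le_trans a00 aa0.
have bgt0 : 0 < b by lra.
have dsmall : d / a <= d0 / 6.
  rewrite ler_pdivrMr// (le_trans dle2)// mulrAC ler_wpM2l//.
  by rewrite divr_ge0// ltW.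
(* [v'] has the same scaling factor as [uh], so estimates on [u], [v] transfer to [uh], [v'] by
   linearity; replacing [v'] by [vh] costs [d / a]. *)
pose uh := a^-1 *: u; pose vh := b^-1 *: v; pose v' := a^-1 *: v.
have uh1 : `|uh| = 1 by rewrite normrZ gtr0_norm ?invr_gt0// mulVf// gt_eqF.
have vh1 : `|vh| = 1 by rewrite normrZ gtr0_norm ?invr_gt0// mulVf// gt_eqF.
have vv : `|vh - v'| <= d / a.
  rewrite -scalerBl normrZ -/b -{2}(gtr0_norm bgt0) -normrM mulrBl mulVf ?gt_eqF//.
  rewrite -(mulVf (lt0r_neq0 agt0)) -mulrBr normrM gtr0_norm ?invr_gt0// mulrC.
  by rewrite ler_wpM2r ?invr_ge0 ?(ltW agt0)// ltW.
have sum : (a + b - d) / a - d / a <= `|uh + vh|.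
  have -> : uh + vh = a^-1 *: (u + v) + (vh - v').
    by rewrite scalerDr -addrA (addrC (a^-1 *: v)) subrK.
  apply: le_trans (lerB_normD _ _); rewrite lerB//.
  by rewrite normrZ gtr0_norm ?invr_gt0// mulrC ler_wpM2l ?invr_ge0 ?(ltW agt0)//; lra.
have fuv : `|f (u - v) : R| / a - d / a <= `|f (uh - vh) : R|.
  have -> : f (uh - vh) = a^-1 * f (u - v) - f (vh - v') :> R.
    rewrite -[a^-1 * _]/(a^-1 *: f (u - v)) -linearZ -linearB; congr (f _).
    by rewrite scalerBr opprB addrA subrK.
  apply: le_trans (lerB_dist _ _); rewrite lerB ?(le_trans (fB _))//.
  by rewrite normrM gtr0_norm ?invr_gt0// mulrC.
have zz : (al + be) * `|a^-1 *: z - zh| <= 3 * (d / a).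
  rewrite /zh; have [->|z0] := eqVneq z 0.
    by rewrite !scaler0 subrr normr0 mulr0 mulr_ge0// divr_ge0// ltW.
  have nz : 0 < `|z| by rewrite normr_gt0.
  rewrite -scalerBl normrZ -{2}(gtr0_norm nz) -normrM mulrBl mulVf ?gt_eqF//.
  rewrite -{1}(mulVf (lt0r_neq0 agt0)) -mulrBr normrM gtr0_norm ?invr_gt0//.
  by rewrite mulrCA mulrC [leRHS]mulrA ler_wpM2r// invr_ge0 ltW.
have close : `|al *: (uh - zh) + be *: (vh - zh)| < d0.
  have -> : al *: (uh - zh) + be *: (vh - zh) =
      a^-1 *: (al *: (u - z) + be *: (v - z)) + be *: (vh - v')
      + (al + be) *: (a^-1 *: z - zh).
    have -> : a^-1 *: (al *: (u - z) + be *: (v - z)) =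
        al *: (uh - a^-1 *: z) + be *: (v' - a^-1 *: z).
      by rewrite scalerDr !scalerA -!scalerBr !scalerA !(mulrC a^-1).
    rewrite scalerDl -(addrA (al *: (uh - a^-1 *: z))) addrACA -!scalerDr.
    congr (_ *: _ + _ *: _); first by rewrite addrA subrK.
    by rewrite [v' - _ + _]addrC !addrA !subrK.
  have n1 : `|a^-1 *: (al *: (u - z) + be *: (v - z))| <= d / a.
    by rewrite normrZ gtr0_norm ?invr_gt0// mulrC ler_wpM2r
      ?invr_ge0 ?(ltW agt0) ?(ltW h3).
  have n2 : `|be *: (vh - v')| <= d / a.
    rewrite normrZ ger0_norm//; apply: le_trans vv.
    by rewrite ler_piMl//; lra.
  have n3 : `|(al + be) *: (a^-1 *: z - zh)| <= 3 * (d / a).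
    by rewrite normrZ ger0_norm//; lra.
  have := ler_normD (a^-1 *: (al *: (u - z) + be *: (v - z)) + be *: (vh - v'))
    ((al + be) *: (a^-1 *: z - zh)).
  have := ler_normD (a^-1 *: (al *: (u - z) + be *: (v - z))) (be *: (vh - v')).
  lra.
have wide : 2 - d0 < `|uh + vh|.
  have : - d / a <= b / a - 1.
    by rewrite -(mulfV (lt0r_neq0 agt0)) -mulrBl ler_wpM2r ?invr_ge0 ?(ltW agt0)//; lra.
  have : (a + b - d) / a = 1 + b / a - d / a by rewrite !mulrDl mulNr mulfV// gt_eqF.
  rewrite mulNr; lra.
have := Hd uh vh uh1 vh1 wide close.
have : eps / 2 <= `|f (u - v) : R| / a.
  by rewrite ler_pdivlMr// (le_trans _ hf)// mulrAC ler_pdivrMr// ler_wpM2l// ltW.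
have : d / a <= eps / 8.
  by rewrite ler_pdivrMr// (le_trans dle3)// ler_wpM2l// divr_ge0// ltW.
lra.
Qed.

End PairRotundity.

(** * Single coordinates, truncations and functionals on [lp] *)

Section Lp.
Context {R : realType} {p : R} (p1 : 1 < p) (X : completeNormedModType R).
Let p0 : 0 < p. Proof. exact: lt_trans p1. Qed.
Local Notation lp := (lpspace (ltW p1) X).
Implicit Types x w : lp.

Definition lp_eval i x : X := x i.

Lemma lp_eval_is_linear i : linear (lp_eval i).
Proof. by move=> a x y. Qed.

HB.instance Definition _ i :=
  GRing.isLinear.Build R lp X _ (lp_eval i) (lp_eval_is_linear i).

Lemma lp_addE x w i : (x + w) i = x i + w i. Proof. by []. Qed.

Lemma lp_subE x w i : (x - w) i = x i - w i. Proof. by []. Qed.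

Lemma lp_scaleE (a : R) x i : (a *: x) i = a *: x i. Proof. by []. Qed.

Lemma lp_sum_coord (I : Type) (r : seq I) (P : pred I) (F : I -> lp) i :
  (\sum_(j <- r | P j) F j) i = \sum_(j <- r | P j) F j i.
Proof. exact: (raddf_sum (lp_eval i)). Qed.

Lemma lp_norm_le x (c : R) : 0 <= c ->
  (forall n, \sum_(0 <= i < n) `|x i| `^ p <= c `^ p) -> `|x| <= c.
Proof. by move=> c0 xc; rewrite lp_normr -lee_fin lp_normE lp_enorm_le. Qed.

Lemma lp_norm_ge x n : \sum_(0 <= i < n) `|x i| `^ p <= `|x| `^ p.
Proof. by apply: lp_enorm_ge => //; rewrite lp_normr lp_normE. Qed.

Definition single_fun i (a : X) : nat -> X := fun j => if j == i then a else 0.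

Lemma single_sum_le i a n :
  \sum_(0 <= j < n) `|single_fun i a j| `^ p <= `|a| `^ p.
Proof.
rewrite /single_fun; have [ni|ni] := leqP n i.
  rewrite big_nat big1 ?powR_ge0// => j /= jn.
  by rewrite ltn_eqF ?(leq_trans jn)// normr0 powR0// gt_eqF.
rewrite (bigD1_seq i) ?mem_index_iota ?iota_uniq//= eqxx big1 ?addr0//.
by move=> j /negPf ->; rewrite normr0 powR0// gt_eqF.
Qed.

Lemma single_funP i a : single_fun i a \in lp_pred (X := X) (ltW p1).
Proof.
apply/lp_predP; apply: (@le_lt_trans _ _ (`|a|%:E)); last exact: ltry.
by apply: lp_enorm_le => // n; exact: single_sum_le.
Qed.

Definition lp_single i a : lp := LpSpace (single_funP i a).

Lemma lp_single_is_linear i : linear (lp_single i).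
Proof.
move=> c a b; apply/val_inj/funext => j /=.
rewrite /single_fun -[RHS]/(c *: (if j == i then a else 0) + if j == i then b else 0).
by case: ifP; rewrite // scaler0 addr0.
Qed.

HB.instance Definition _ i :=
  GRing.isLinear.Build R X lp _ (lp_single i) (lp_single_is_linear i).

Lemma lp_singleE i a j : lp_single i a j = if j == i then a else 0.
Proof. by []. Qed.

Lemma norm_lp_single i a : `|lp_single i a| = `|a|.
Proof.
apply/eqP; rewrite eq_le; apply/andP; split.
  by apply: lp_norm_le => // n; exact: single_sum_le.
by have := lp_norm_coord (lp_single i a) i; rewrite lp_singleE eqxx.
Qed.

Definition lp_trunc N x : lp := \sum_(i < N) lp_single i (x i).

Lemma lp_truncE N x j : lp_trunc N x j = if (j < N)%N then x j else 0.
Proof.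
rewrite lp_sum_coord; case: ltnP => jN.
  rewrite (bigD1 (Ordinal jN))// lp_singleE eqxx big1 => [|i ij].
    by rewrite /= addr0.
  rewrite lp_singleE; case: eqP => // ji; case/eqP: ij; exact/val_inj.
rewrite big1// => i _; rewrite lp_singleE; case: eqP => // ji.
by move: (ltn_ord i); rewrite -ji ltnNge jN.
Qed.

Lemma lp_trunc_le N x : `|lp_trunc N x| <= `|x|.
Proof.
apply: lp_norm_le => // n; apply: le_trans (lp_norm_ge x n).
apply: ler_sum => i _; rewrite lp_truncE; case: ifP => // _.
by rewrite normr0 powR0 ?powR_ge0// gt_eqF.
Qed.

Lemma lp_norm_disjoint x w (c : R) : 0 <= c ->
  (forall i, x i = 0 \/ w i = 0) -> `|x| `^ p + `|w| `^ p <= c `^ p ->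
  `|x + w| <= c.
Proof.
move=> c0 xw le; apply: lp_norm_le => // n; apply: le_trans le.
apply: (@le_trans _ _ (\sum_(0 <= i < n) (`|x i| `^ p + `|w i| `^ p))).
  apply: ler_sum => i _; rewrite lp_addE.
  case: (xw i) => ->; rewrite normr0 powR0 ?gt_eqF//.
    by rewrite !add0r.
  by rewrite !addr0.
by rewrite big_split lerD// lp_norm_ge.
Qed.

(** If every tail had norm above [eta], each partial sum of the powers would stay [eta ^ p] below
    [|x| ^ p], and so would their supremum. *)
Lemma lp_trunc_cvg x (eta : R) : 0 < eta ->
  exists N, `|x - lp_trunc N x| <= eta.
Proof.
move=> eta0; set S := `|x| `^ p; apply: contrapT => no.
have e0 : 0 < eta `^ p by exact: powR_gt0.
have far N : \sum_(0 <= i < N) `|x i| `^ p <= S - eta `^ p.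
  rewrite leNgt; apply/negP => big; apply: no; exists N.
  apply: lp_norm_le => [|n]; first exact: ltW.
  have [nN|Nn] := leqP n N.
    rewrite big_nat big1 ?powR_ge0// => i /andP[_ iN].
    rewrite lp_subE lp_truncE (leq_trans iN nN).
    by rewrite subrr normr0 powR0// gt_eqF.
  have low : \sum_(0 <= i < N) `|(x - lp_trunc N x) i| `^ p = 0.
    rewrite big_nat big1// => i /andP[_ iN].
    by rewrite lp_subE lp_truncE iN subrr normr0 powR0// gt_eqF.
  have high : \sum_(N <= i < n) `|(x - lp_trunc N x) i| `^ p =
      \sum_(N <= i < n) `|x i| `^ p.
    apply: eq_big_nat => i /andP[Ni _].
    by rewrite lp_subE lp_truncE ltnNge Ni subr0.
  have := lp_norm_ge x n; rewrite !(big_cat_nat (leq0n N) (ltnW Nn))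
    low high -/S /= add0r.
  move: big; lra.
have S0 : 0 <= S - eta `^ p by have := far 0%N; rewrite big_nil.
pose c := (S - eta `^ p) `^ p^-1.
have cE : c `^ p = S - eta `^ p by rewrite -powRrM mulVf ?gt_eqF// powRr1.
have : `|x| <= c by apply: lp_norm_le => [|n]; rewrite ?powR_ge0// cE.
move=> /(ge0_ler_powR (ltW p0)); rewrite !nnegrE normr_ge0 powR_ge0 cE.
move=> /(_ isT isT); rewrite -/S; lra.
Qed.

(** Let [x] almost attain the norm [M] of [f], truncated at [N]. For [w] in the unit ball supported
    beyond [N], adding [t w] to it raises the norm bound only from [1] to [1 + t ^ p], while [f]
    changes by [t f w]. As [p > 1], [t ^ p] is negligible against [t], so [f w] is small. *)
Lemma lp_functional_tail (f : {linear lp -> R^o}) (eps : R) :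
  continuous f -> 0 < eps ->
  exists N, forall w, (forall i, (i < N)%N -> w i = 0) -> `|f w : R| <= eps * `|w|.
Proof.
move=> fc eps0.
have M0 := dual_norm_ge0 fc; set M := dual_norm f in M0.
have q0 : 0 < p - 1 by rewrite subr_gt0.
(* [t] solves [t ^ (p - 1) = b], so that [M t ^ p] is at most [eps / 2 * t]. *)
pose b := eps / (2 * (M + 1)).
have b0 : 0 < b by rewrite divr_gt0// mulr_gt0//; lra.
pose t := b `^ (p - 1)^-1.
have t0 : 0 < t by exact: powR_gt0.
have tq : M * t `^ p <= eps / 2 * t.
  rewrite -(mulr_powRB1 (ltW t0) p0) mulrCA mulrC ler_wpM2r ?(ltW t0)//.
  rewrite /t -powRrM mulVf ?gt_eqF// powRr1 ?(ltW b0)//.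
  have : (M + 1) * b = eps / 2 by rewrite /b invfM mulrCA mulrA; field; lra.
  lra.
(* [x] misses the supremum by at most [eta] and its truncation costs at most [M * eta]: together
   [eps / 2 * t]. *)
pose eta := eps / 2 * t / (M + 1).
have eta0 : 0 < eta by rewrite divr_gt0 ?mulr_gt0//; lra.
have etaM : (M + 1) * eta = eps / 2 * t by rewrite /eta mulrC divfK// gt_eqF//; lra.
have [_ [x /= x1 <-] xM] := sup_adherent eta0 (dual_norm_has_sup fc).
wlog fx0 : x x1 xM / 0 <= (f x : R) => [wl|].
  have [/wl|/ltW fx0] := leP 0 (f x : R); first exact.
  by apply: (wl (- x)); rewrite ?normrN ?linearN ?oppr_ge0//= normrN.
have [N xN] := lp_trunc_cvg x eta0.
exists N.
have key w : (forall i, (i < N)%N -> w i = 0) -> `|w| <= 1 -> f w <= eps.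
  move=> w0 w1.
  have disj : `|lp_trunc N x + t *: w| <= (1 + t `^ p).
    apply: lp_norm_disjoint; first by rewrite addr_ge0// powR_ge0.
      move=> i; rewrite lp_truncE lp_scaleE.
      by case: ltnP => iN; [right; rewrite w0// scaler0|left].
    apply: (@le_trans _ _ (1 + t `^ p)).
      rewrite lerD//.
        have pw1 : (1 : R) `^ p = 1 by rewrite powR1.
        rewrite -[leRHS]pw1 ge0_ler_powR ?nnegrE ?(ltW p0)//.
        exact: le_trans (lp_trunc_le N x) x1.
      rewrite ge0_ler_powR ?nnegrE ?(ltW p0) ?(ltW t0)//.
      by rewrite normrZ gtr0_norm// ler_piMr// ltW.
    by rewrite le1r_powR ?(ltW p1)// lerDl powR_ge0.
  have A := normr_le_dual_norm (lp_trunc N x + t *: w) fc.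
  have B := normr_le_dual_norm (x - lp_trunc N x) fc.
  move: A; rewrite linearD linearZ -/M => A.
  move: B; rewrite linearB -/M => B.
  have A' : M * `|lp_trunc N x + t *: w| <= M * (1 + t `^ p) by rewrite ler_wpM2l.
  have B' : M * `|x - lp_trunc N x| <= M * eta by rewrite ler_wpM2l.
  have A2 : f (lp_trunc N x) + t * f w <= M * (1 + t `^ p).
    exact: le_trans (ler_norm _) (le_trans A A').
  have B2 : f x - f (lp_trunc N x) <= M * eta.
    exact: le_trans (ler_norm _) (le_trans B B').
  rewrite (ger0_norm fx0) -/(dual_norm f) -/M in xM.
  rewrite -(ler_pM2l t0); lra.
have key2 w : (forall i, (i < N)%N -> w i = 0) -> `|w| <= 1 -> `|f w : R| <= eps.
  move=> w0 w1; rewrite ler_norml; apply/andP; split; last exact: key.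
  rewrite lerNl -linearN; apply: key; rewrite ?normrN// => i iN.
  by rewrite -[(- w) i]/(- w i) w0// oppr0.
move=> w w0; have [->|wn0] := eqVneq w 0; first by rewrite linear0 !normr0 mulr0.
have nw : 0 < `|w| by rewrite normr_gt0.
have := key2 (`|w|^-1 *: w); rewrite linearZ !normrZ normfV normr_id mulVf ?gt_eqF//.
rewrite ler_pdivrMl// mulrC; apply => // i iN.
by rewrite lp_scaleE w0// scaler0.
Qed.

End Lp.

Lemma bigmin_gt0 (R : realDomainType) (n : nat) (F : 'I_n -> R) :
  (forall i, 0 < F i) -> exists2 m : R, 0 < m & forall i, m <= F i.
Proof.
move=> F0; exists (\big[Num.min/1]_(i < n) F i); last by move=> i; exact: bigmin_le.
by elim/big_ind : _ => // x y x0 y0; rewrite lt_min x0.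
Qed.

(** * Passage of pair rotundity from [X] to [lp] *)

Section LpPairRotund.
Context {R : realType} {p : R} (p1 : 1 < p) (X : completeNormedModType R).
Let p0 : 0 < p. Proof. exact: lt_trans p1. Qed.
Local Notation lp := (lpspace (ltW p1) X).

Definition midpoint_gap (a b : X) : R :=
  (`|a| `^ p + `|b| `^ p) / 2 - (`|a + b| / 2) `^ p.

Lemma midpoint_gap_ge0 a b : 0 <= midpoint_gap a b.
Proof.
rewrite subr_ge0; apply: le_trans (powR_midpoint p1 (normr_ge0 a) (normr_ge0 b)).
rewrite ge0_ler_powR ?nnegrE ?(ltW p0) ?divr_ge0 ?addr_ge0//.
by rewrite ler_pM2r ?invr_gt0// ler_normD.
Qed.

(* The midpoint gap of [u, v] in [lp] is the sum of those of their coordinates. *)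
Lemma lp_midpoint_gap (u v : lp) i : `|u| = 1 -> `|v| = 1 ->
  (`|u + v| / 2) `^ p <= 1 - midpoint_gap (u i) (v i).
Proof.
move=> u1 v1; set g := midpoint_gap (u i) (v i).
have pw1 : (1 : R) `^ p = 1 by rewrite powR1.
have sums n : \sum_(0 <= j < n) (`|u j + v j| / 2) `^ p <= 1 - g.
  pose m := maxn n i.+1.
  apply: (@le_trans _ _ (\sum_(0 <= j < m) (`|u j + v j| / 2) `^ p)).
    rewrite (big_cat_nat (leq0n n) (leq_maxl n i.+1)) /= lerDl.
    by apply: sumr_ge0 => j _; exact: powR_ge0.
  have gi : g <= \sum_(0 <= j < m) midpoint_gap (u j) (v j).
    rewrite (bigD1_seq i) ?mem_index_iota ?iota_uniq ?leq_maxr//= lerDl.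
    by apply: sumr_ge0 => j _; exact: midpoint_gap_ge0.
  have := lp_norm_ge u m; have := lp_norm_ge v m; rewrite u1 v1 pw1.
  move: gi; rewrite sumrB -mulr_suml big_split/=; lra.
have g1 : 0 <= 1 - g by have := sums 0%N; rewrite big_nil.
have h : `|u + v| / 2 = `|2^-1 *: (u + v)|.
  by rewrite normrZ gtr0_norm ?invr_gt0// mulrC.
pose c := (1 - g) `^ p^-1.
have cE : c `^ p = 1 - g by rewrite -powRrM mulVf ?gt_eqF// powRr1.
rewrite h -cE ge0_ler_powR ?nnegrE ?(ltW p0) ?powR_ge0//.
apply: lp_norm_le => [|n]; rewrite ?powR_ge0// cE; apply: le_trans (sums n).
apply: ler_sum => j _; rewrite lp_scaleE lp_addE.
by rewrite normrZ gtr0_norm ?invr_gt0// mulrC.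
Qed.

(** Beyond some [N] the functional is negligible. On each of the first [N] coordinates the midpoint
    gap is small, so the norms of [u i] and [v i] are almost equal and almost additive, and pair
    rotundity of [X] applies to [f] restricted to that coordinate. *)
Lemma lp_unit_pair_rotund (al be : R) :
  pair_rotund al be X -> unit_pair_rotund al be lp.
Proof.
move=> HX f z eps fS eps0.
have fc : continuous f by case: fS.
have e80 : 0 < eps / 8 by rewrite divr_gt0.
have [N tail] := lp_functional_tail fc e80.
(* With [N.+1] in place of [N] the quotient makes sense for [N = 0], and the [N] coordinates
   contribute strictly less than [eps / 2]. *)
pose e1 := eps / (2 * N.+1%:R).
have e10 : 0 < e1 by rewrite divr_gt0// mulr_gt0// ltr0n.
pose fi i : {linear X -> R^o} := (f \o lp_single p1 i).
have fic i : continuous (fi i).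
  apply: (@linear_continuous_of_bound _ _ _ 1) => a; rewrite mul1r.
  by apply: le_trans (dual_unit_sphere_le _ fS) _; rewrite norm_lp_single.
have /choice[dd Hdd] (i : 'I_N) : exists d : R, 0 < d /\ forall u v : X,
    `|u| <= 2 -> `| `|u| - `|v| | < d -> `|u| + `|v| - `|u + v| < d ->
    `|al *: (u - z i) + be *: (v - z i)| < d -> `|fi i (u - v) : R| < e1.
  by have [d d0 H] := HX (fi i) (z i) e1 (fic i) e10; exists d.
have [m m0 mdd] := bigmin_gt0 (fun i => proj1 (Hdd i)).
have [g g0 Hg] := powR_midpoint_uniform p1 m0.
(* By the tangent at [1], [|u + v| > 2 - 2 * g / p] puts the power of [|u + v| / 2] above
   [1 - g]. *)
exists (Num.min m (2 * g / p)); first by rewrite lt_min m0 divr_gt0 ?mulr_gt0.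
move=> u v u1 v1 uv; rewrite lt_min => /andP[uvz _].
have {}uv : 2 - 2 * g / p < `|u + v|.
  by apply: le_lt_trans uv; rewrite lerD2l lerN2 ge_min lexx orbT.
have small : 1 - (`|u + v| / 2) `^ p < g.
  have s0 : 0 <= `|u + v| / 2 by rewrite divr_ge0.
  have := ler_powR_tangent p1 s0.
  have : p * (2 - 2 * g / p) < p * `|u + v| by rewrite ltr_pM2l.
  rewrite mulrBr [p * (_ / p)]mulrC divfK ?gt_eqF//; lra.
have coord (x : lp) i : `|x| = 1 -> `|x i| <= 1.
  by move=> x1; rewrite (le_trans (lp_norm_coord x i))// x1.
have fiuv (i : 'I_N) : `|f (lp_single p1 i ((u - v) i)) : R| < e1.
  have [_ H] := Hdd i.
  have gi := lp_midpoint_gap i u1 v1.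
  have [|A B] := Hg `|u i| `|v i| `|u i + v i| (normr_ge0 _) (coord u i u1)
    (normr_ge0 _) (coord v i v1) (normr_ge0 _) (ler_normD _ _).
    by rewrite -/(midpoint_gap (u i) (v i)); lra.
  rewrite lp_subE; apply: H.
  - by rewrite (le_trans (coord u i u1))// ler1n.
  - exact: lt_le_trans A (mdd i).
  - exact: lt_le_trans B (mdd i).
  - apply: lt_le_trans (mdd i); apply: le_lt_trans uvz.
    exact: (lp_norm_coord (al *: (u - z) + be *: (v - z)) i).
set w := u - v in fiuv *.
have head : `|f (lp_trunc N w) : R| <= eps / 2 * (N%:R / N.+1%:R).
  rewrite linear_sum; apply: le_trans (ler_norm_sum _ _ _) _.
  apply: (@le_trans _ _ (\sum_(i < N) e1)).
    by apply: ler_sum => i _; exact/ltW/fiuv.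
  have e1E : e1 = eps / 2 / N.+1%:R by rewrite /e1 invfM mulrA.
  by rewrite sumr_const card_ord -[_ *+ N]mulr_natr e1E mulrAC [leRHS]mulrA.
have lt1 : N%:R / N.+1%:R < 1 :> R.
  by rewrite ltr_pdivrMr ?ltr0n// mul1r ltr_nat.
move: head lt1; set r := _ / N.+1%:R => head lt1.
have w2 : `|w| <= 2 by apply: le_trans (ler_normB _ _) _; rewrite u1 v1; lra.
have tw : `|f (w - lp_trunc N w) : R| <= eps / 8 * `|w - lp_trunc N w|.
  by apply: tail => i iN; rewrite lp_subE lp_truncE iN subrr.
have tw4 : `|w - lp_trunc N w| <= 4.
  apply: le_trans (ler_normB _ _) _; have := lp_trunc_le N w; lra.
have tw' : `|f (w - lp_trunc N w) : R| <= eps / 2.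
  apply: le_trans tw _; apply: (@le_trans _ _ (eps / 8 * 4)); last lra.
  by rewrite ler_wpM2l// ltW.
have -> : f w = f (lp_trunc N w) + f (w - lp_trunc N w) :> R.
  by rewrite -[RHS]linearD addrC subrK.
apply: le_lt_trans (ler_normD _ _) (le_lt_trans (lerD head tw') _).
have : eps / 2 * r < eps / 2 * 1 by rewrite ltr_pM2l// divr_gt0.
lra.
Qed.

End LpPairRotund.

(** * Reduction and estimates of the determinants [Ddet] *)

Section Determinants.
Context {R : realType}.

Lemma norm_det_le (k : nat) (A : 'M[R]_k) (c : R) :
  (forall i j, `|A i j| <= c) -> `|\det A| <= k`!%:R * c ^+ k.
Proof.
move=> Ac; apply: le_trans (ler_norm_sum _ _ _) _.
apply: (@le_trans _ _ (\sum_(s : 'S_k) c ^+ k)).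
  apply: ler_sum => s _; rewrite normrM normrX normrN1 expr1n mul1r normr_prod.
  rewrite -[in leRHS](card_ord k) -prodr_const; apply: ler_prod => i _.
  by rewrite normr_ge0 Ac.
by rewrite sumr_const card_Sn mulr_natl.
Qed.

(** Right multiplication by the unipotent [U] subtracts the first column from the others and turns
    the row of ones into [(1, 0, ..., 0)]. *)
Lemma Ddet_diff (k : nat) (Z : completeNormedModType R) (z : 'I_k.+1 -> Z)
    (f : 'I_k -> {linear Z -> R^o}) :
  Ddet z f =
  \det (\matrix_(j < k, i < k) (f j (z (lift ord0 i)) - f j (z ord0) : R)).
Proof.
rewrite /Ddet; set M := (X in \det X = _); set D := (X in _ = \det X).
pose U : 'M[R]_(1 + k) := block_mx 1%:M (const_mx (- 1)) 0 1%:M.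
have detU : \det U = 1 by rewrite det_ublock !det1 mulr1.
have -> : \det M = \det ((M : 'M[R]_(1 + k)) *m U) by rewrite det_mulmx detU mulr1.
pose C : 'M[R]_(k, 1) := \col_j f j (z ord0).
have -> : (M : 'M[R]_(1 + k)) *m U = block_mx 1%:M 0 C D.
  rewrite -[M : 'M[R]_(1 + k)](@submxK R 1 k 1 k) mulmx_block !mulmx1 !mulmx0 !addr0.
  have l0 (i : 'I_1) : lshift k i = ord0 by apply/val_inj; rewrite /= (ord1 i).
  congr block_mx; apply/matrixP => i j; rewrite !mxE
    ?big_ord1 ?mxE !l0 ?rshift1 ?unlift_none ?liftK.
  - by rewrite (ord1 i) (ord1 j).
  - by rewrite mul1r addrC subrr.
  - by [].
  - by rewrite mulrN1 addrC.
by rewrite det_lblock det1 mul1r.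
Qed.

Lemma Ddet_small (k : nat) (eps : R) : (0 < k)%N -> 0 < eps ->
  exists2 eta : R, 0 < eta &
    forall (Z : completeNormedModType R) (z : 'I_k.+1 -> Z)
      (f : 'I_k -> {linear Z -> R^o}),
    (forall j i, `|f j (z i - z ord0) : R| < eta) -> `|Ddet z f| < eps.
Proof.
move=> k0 eps0; have kf0 : 0 < k`!%:R :> R by rewrite ltr0n fact_gt0.
(* The bound [1] gives [eta ^+ k <= eta], as [k > 0]. *)
pose eta := Num.min 1 (eps / 2 / k`!%:R).
have eta0 : 0 < eta by rewrite lt_min ltr01 !divr_gt0.
exists eta => // Z z f small; rewrite Ddet_diff.
apply: (@le_lt_trans _ _ (k`!%:R * eta ^+ k)).
  by apply: norm_det_le => j i; rewrite mxE -linearB ltW.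
apply: (@le_lt_trans _ _ (k`!%:R * eta)).
  rewrite ler_pM2l// -[leRHS]expr1 ler_wiXn2l ?(ltW eta0)// ge_min lexx//.
apply: (@le_lt_trans _ _ (eps / 2)); last lra.
by rewrite mulrC -ler_pdivlMr// ge_min lexx orbT.
Qed.

End Determinants.

(** * From pair rotundity to the [k]-fold notions *)

Section FromPairRotund.
Context {R : realType}.
Implicit Types (Z : completeNormedModType R) (k : nat).

Lemma inf_with1_gt0 (S : set R) : (0 < inf ([set 1] `|` S)) <->
  (exists2 d : R, 0 < d & forall x, S x -> d <= x).
Proof.
split=> [i0|[d d0 Sd]].
  exists (inf ([set 1] `|` S)) => // x Sx; apply: ge_inf; last by right.
  (* A set unbounded below has [inf] equal to [0] by default, which a positive infimum rules out. *)
  apply: contrapT => nlb; move: i0; rewrite inf_out ?ltxx// => -[_ lb]; exact: nlb.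
apply: (@lt_le_trans _ _ (Num.min d 1)); first by rewrite lt_min d0 ltr01.
apply: lb_le_inf; first by exists 1; left.
move=> x [->|/Sd dx]; first by rewrite ge_min lexx orbT.
by rewrite ge_min dx.
Qed.

(** The remaining [k - 1] unit vectors contribute at most [k - 1] to the norm of the sum. This
    reduces averages to pairs. *)
Lemma norm_pair_ge k Z (z : 'I_k.+1 -> Z) (i : 'I_k) :
  (forall j, `|z j| = 1) ->
  `|\sum_j z j| - k%:R + 1 <= `|z ord0 + z (lift ord0 i)|.
Proof.
move=> z1; rewrite big_ord_recl (bigD1 i)//= addrA.
set s := \sum_(_ | _) _.
have sk : `|s| <= k%:R - 1.
  apply: le_trans (ler_norm_sum _ _ _) _; under eq_bigr do rewrite z1.
  have : \sum_(j < k) (1 : R) = k%:R by rewrite sumr_const card_ord.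
  rewrite (bigD1 i)//=; lra.
have := ler_normD (z ord0 + z (lift ord0 i)) s; lra.
Qed.

(** Common core of the uniform case ([al = 0]) and the local case ([al = 1], first vector [z0]):
    each pair [z ord0], [z i] has a sum of norm near [2], so all entries of the difference matrix
    are small. *)
Lemma pair_rotund_Ddet k Z (al : R) (f : 'I_k -> {linear Z -> R^o}) (z0 : Z) (eps : R) :
  (0 < k)%N -> unit_pair_rotund al 0 Z -> (forall j, dual_unit_sphere (f j)) ->
  0 < eps -> exists2 d : R, 0 < d & forall z : 'I_k.+1 -> Z,
    (forall i, `|z i| = 1) -> `|al *: (z ord0 - z0)| < d ->
    1 - k.+1%:R^-1 * `|\sum_i z i| < d -> `|Ddet z f| < eps.
Proof.
move=> k0 G fS eps0; have [eta eta0 small] := Ddet_small k0 eps0.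
have /choice[dd Hdd] (j : 'I_k) : exists d : R, 0 < d /\ forall u v : Z,
    `|u| = 1 -> `|v| = 1 -> 2 - d < `|u + v| ->
    `|al *: (u - z0) + 0 *: (v - z0)| < d -> `|f j (u - v) : R| < eta.
  by have [d d0 H] := G (f j) z0 eta (fS j) eta0; exists d.
have [m m0 mdd] := bigmin_gt0 (fun j => proj1 (Hdd j)).
have kp : 0 < k.+1%:R :> R by rewrite ltr0n.
exists (m / k.+1%:R); first by rewrite divr_gt0.
have mk : m / k.+1%:R <= m by rewrite ler_pdivrMr// ler_peMr ?(ltW m0)// ler1n.
move=> z z1 zz0 zs; apply: small => j i.
case: (unliftP ord0 i) => [i'|] ->; last by rewrite subrr linear0 normr0.
(* The sign is flipped to put [z ord0] first in the pair, where the side condition applies. *)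
rewrite -opprB linearN normrN; have [_ H] := Hdd j; apply: H => //.
  apply: le_lt_trans (_ : 2 - m < _); first by rewrite lerD2l lerN2.
  apply: lt_le_trans (norm_pair_ge i' z1).
  have : k.+1%:R * (1 - k.+1%:R^-1 * `|\sum_i z i|) < k.+1%:R * (m / k.+1%:R).
    by rewrite ltr_pM2l.
  rewrite mulrBr mulr1 mulVKf ?gt_eqF// [X in _ < X]mulrC divfK ?gt_eqF// -natr1; lra.
rewrite scale0r addr0; apply: lt_le_trans (mdd j); exact: lt_le_trans zz0 mk.
Qed.

Lemma kWUR_of_pair_rotund k Z : (0 < k)%N -> unit_pair_rotund 0 0 Z -> kWUR k Z.
Proof.
move=> k0 G eps f eps0 fS; apply/inf_with1_gt0.
have [d d0 Hd] := pair_rotund_Ddet 0 k0 G fS eps0.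
exists d => // _ [z [z1 zD] <-]; rewrite leNgt; apply/negP => small.
have := Hd z z1 _ small; rewrite scale0r normr0 => /(_ d0).
by rewrite ltNge zD.
Qed.

Lemma ord_cons0 k Z (z0 : Z) (z : 'I_k -> Z) : ord_cons z0 z ord0 = z0.
Proof. by rewrite /ord_cons unlift_none. Qed.

Lemma ord_cons_lift k Z (z0 : Z) (z : 'I_k -> Z) i :
  ord_cons z0 z (lift ord0 i) = z i.
Proof. by rewrite /ord_cons liftK. Qed.

Lemma ord_cons_sum k Z (z0 : Z) (z : 'I_k -> Z) :
  \sum_i ord_cons z0 z i = z0 + \sum_i z i.
Proof.
by rewrite big_ord_recl ord_cons0; congr (_ + _); apply: eq_bigr => i _;
  rewrite ord_cons_lift.
Qed.

Lemma kWLUR_of_pair_rotund k Z : (0 < k)%N -> unit_pair_rotund 1 0 Z -> kWLUR k Z.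
Proof.
move=> k0 G z0 eps f z01 eps0 fS; apply/inf_with1_gt0.
have [d d0 Hd] := pair_rotund_Ddet z0 k0 G fS eps0.
exists d => // _ [z [z1 zD] <-]; rewrite leNgt; apply/negP => small.
suff : `|Ddet (ord_cons z0 z) f| < eps by rewrite ltNge zD.
apply: Hd; rewrite ?ord_cons_sum ?ord_cons0 ?subrr ?scaler0 ?normr0// => i.
by case: (unliftP ord0 i) => [j|] ->; rewrite ?ord_cons_lift ?ord_cons0//; exact: z1.
Qed.

(** The pairs are points symmetric about [z0]. Their norms are only close to [1], hence the
    homogeneous hypothesis. *)
Lemma kWMLUR_of_pair_rotund k Z : (0 < k)%N -> pair_rotund 1 1 Z -> kWMLUR k Z.
Proof.
move=> k0 H z0 z z01 z1 zcvg f fS; apply/cvgrPdist_lt => eps eps0.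
have [eta eta0 small] := Ddet_small k0 eps0.
have kp : 0 < k%:R :> R by rewrite ltr0n.
have k1 : 1 <= k%:R :> R by rewrite ler1n.
have ek : 0 < eta / k%:R by rewrite divr_gt0.
have /choice[dd Hdd] (j : 'I_k) : exists d : R, 0 < d /\ forall u v : Z,
    `|u| <= 2 -> `| `|u| - `|v| | < d -> `|u| + `|v| - `|u + v| < d ->
    `|1 *: (u - z0) + 1 *: (v - z0)| < d -> `|f j (u - v) : R| < eta / k%:R.
  by have [d d0 Hd] := H (f j) z0 (eta / k%:R) (proj1 (fS j)) ek; exists d.
have [m m0 mdd] := bigmin_gt0 (fun j => proj1 (Hdd j)).
(* The bound [1] keeps [|u| <= 2]; [m / 3] covers the norm differences, which are at most twice the
   residual [sg]. *)
have m3 : 0 < Num.min 1 (m / 3) by rewrite lt_min ltr01 divr_gt0.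
move/cvgrPdist_lt : zcvg => /(_ _ m3); apply: filterS => n.
rewrite sub0r normrN normr_id; set sg := `|_| => sgm.
rewrite sub0r normrN; apply: small => j i.
have {}sgm : sg < 1 /\ sg < m / 3 by move: sgm; rewrite lt_min => /andP[].
(* [z0] is the midpoint of [z0 - t] and [z0 + t], which lie in the ball of
   radius [1 + sg]. *)
have close i' : `|f j (z i' n - z0) : R| < eta / 2.
  pose t := k%:R^-1 *: (z i' n - z0).
  pose u := z0 - t; pose v := z0 + t.
  have uv : u + v = 2 *: z0 by rewrite /u /v addrACA addNr addr0 scaler_nat mulr2n.
  (* [v] is a convex combination of [z0] and [z i' n]; [u] is the mean of the other [k] vectors plus
     the residual divided by [k]. *)
  have v1 : `|v| <= 1.
    have -> : v = k%:R^-1 *: ((k%:R - 1) *: z0 + z i' n).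
      rewrite scalerBl scale1r -addrA scalerDr scalerA mulVf ?gt_eqF// scale1r.
      by rewrite [- _ + _]addrC.
    rewrite normrZ gtr0_norm ?invr_gt0// ler_pdivrMl// mulr1.
    apply: le_trans (ler_normD _ _) _; rewrite normrZ z01 z1 mulr1 ger0_norm; lra.
  have u1 : `|u| <= 1 + sg.
    have -> : u = k%:R^-1 *: ((k.+1%:R *: z0 - \sum_i z i n) +
        \sum_(j' | j' != i') z j' n).
      rewrite (bigD1 i')//= opprD addrA subrK -natr1 scalerDl scale1r.
      rewrite -addrA scalerDr scalerA mulVf ?gt_eqF// scale1r /u /t -scalerN.
      by rewrite opprB.
    rewrite normrZ gtr0_norm ?invr_gt0// ler_pdivrMl//.
    apply: le_trans (ler_normD _ _) _; rewrite -/sg.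
    have : `|\sum_(j' | j' != i') z j' n| <= k%:R.
      apply: le_trans (ler_norm_sum _ _ _) _; under eq_bigr do rewrite z1.
      by rewrite sumr_const cardC1 card_ord.
    have : 1 * sg <= k%:R * sg by rewrite ler_wpM2r ?normr_ge0.
    lra.
  have nuv : `|u + v| = 2 by rewrite uv normrZ z01 mulr1 ger0_norm.
  have := ler_normD u v; rewrite nuv => tri.
  have [_ /(_ u v)] := Hdd j.
  have -> : f j (u - v) = - (2 / k%:R) * f j (z i' n - z0) :> R.
    rewrite -[RHS]/(- (2 / k%:R) *: f j (z i' n - z0)) -linearZ; congr (f j _).
    by rewrite /u /v opprD addrACA subrr add0r -mulr2n -scaler_nat scalerN scaleNr /t scalerA.
  rewrite normrM normrN (@gtr0_norm _ (2 / k%:R)) ?divr_gt0// => HH.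
  have : 2 / k%:R * `|f j (z i' n - z0) : R| < eta / k%:R.
    apply: HH.
    - lra.
    - by apply: lt_le_trans (mdd j); rewrite ltr_norml; apply/andP; split; lra.
    - by apply: lt_le_trans (mdd j); lra.
    - rewrite !scale1r addrACA uv -opprD -mulr2n -[z0 *+ 2]scaler_nat subrr normr0.
      exact: proj1 (Hdd j).
  rewrite mulrAC ltr_pM2r ?invr_gt0//; lra.
have := close i; have := close ord0.
have -> : z i n - z ord0 n = (z i n - z0) - (z ord0 n - z0).
  by rewrite opprB addrA subrK.
move=> c0 ci; apply: le_lt_trans (functional_normB _ _ _) _.
by rewrite [ltRHS]splitr ltrD.
Qed.

End FromPairRotund.

(** * From the [k]-fold notions on [Z] back to pairs in [X] *)

Section Blocks.
Local Open Scope classical_set_scope.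
Context {R : realType}.
Implicit Types (X Z : completeNormedModType R) (k : nat).

(** Abstracts what the block argument needs, so that it covers both [k] blocks inside [lp] and, for
    [k = 1], the identity of a space. The functionals [F j] read off the blocks separately. *)
Definition block_embedding k X Z (e : 'I_k -> {linear X -> Z}) : Prop :=
  (forall (x : 'I_k -> X) (c : R), (forall j, `|x j| = c) ->
    `|\sum_j e j (x j)| = c) /\
  (forall f : {linear X -> R^o}, dual_unit_sphere f ->
    exists2 kappa : R, 0 < kappa & exists F : 'I_k -> {linear Z -> R^o},
      (forall j, dual_unit_sphere (F j)) /\
      forall j i x, F j (e i x) = (if i == j then kappa * f x else 0) :> R).

Definition config k X Z (e : 'I_k -> {linear X -> Z}) (u w : X) (i : 'I_k.+1) : Z :=
  \sum_j e j (if lift ord0 j == i then u else w).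

Section Config.
Variables (k : nat) (X Z : completeNormedModType R) (e : 'I_k -> {linear X -> Z}).
Hypothesis eE : block_embedding e.

Lemma norm_blocks (x : X) : `|\sum_j e j x| = `|x|.
Proof. by apply: (proj1 eE). Qed.

Lemma norm_config u w i : `|u| = 1 -> `|w| = 1 -> `|config e u w i| = 1.
Proof. by move=> u1 w1; apply: (proj1 eE) => j; case: ifP. Qed.

(** Each block holds [u] in exactly one of the [k + 1] vectors and [w] in the other [k]. *)
Lemma sum_config u w : \sum_i config e u w i = \sum_j e j (u + k%:R *: w).
Proof.
rewrite exchange_big; apply: eq_bigr => j _ /=; rewrite -linear_sum; congr (e j _).
rewrite (bigD1 (lift ord0 j))//= eqxx; congr (_ + _).
under eq_bigr => i ij do rewrite eq_sym (negPf ij).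
by rewrite sumr_const cardC1 card_ord scaler_nat.
Qed.

Lemma config0 u w : config e u w ord0 = \sum_j e j w.
Proof. by apply: eq_bigr => j _; rewrite eq_sym (negPf (neq_lift _ _)). Qed.

Lemma ord_cons_config u w :
  ord_cons (\sum_j e j w) (fun i => config e u w (lift ord0 i)) = config e u w.
Proof.
apply/funext => i; case: (unliftP ord0 i) => [j|] ->.
  by rewrite ord_cons_lift.
by rewrite ord_cons0 config0.
Qed.

(** Only block [j] of the vector [lift ord0 j] differs from the constant vector, so the difference
    matrix is scalar. *)
Lemma Ddet_config (f : {linear X -> R^o}) (kappa : R)
    (F : 'I_k -> {linear Z -> R^o}) u w :
  (forall j i x, F j (e i x) = (if i == j then kappa * f x else 0) :> R) ->
  Ddet (config e u w) F = (kappa * f (u - w)) ^+ k.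
Proof.
move=> FE; rewrite Ddet_diff.
have FC j i : F j (config e u w i) = kappa * f (if lift ord0 j == i then u else w) :> R.
  rewrite linear_sum (bigD1 j)//= FE eqxx big1 ?addr0// => i' ij.
  by rewrite FE (negPf ij).
rewrite -det_scalar; congr (\det _); apply/matrixP => j i; rewrite !mxE !FC.
rewrite [lift ord0 j == ord0]eq_sym (negPf (neq_lift _ _)) (inj_eq lift_inj) -mulrBr.
case: eqP => _; rewrite ?mulr1n ?mulr0n; last by rewrite subrr mulr0.
by rewrite linearB.
Qed.

(** The sum has the norm of [u + k w = k (u + w) - (k - 1) u], which is at least
    [k |u + w| - (k - 1)]. *)
Lemma norm_config_sum_ge u w : (0 < k)%N -> `|u| = 1 -> `|w| = 1 ->
  1 - k.+1%:R^-1 * `|\sum_i config e u w i| <= 2 - `|u + w|.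
Proof.
move=> k0 u1 w1; rewrite sum_config norm_blocks.
have kp : 0 < k.+1%:R :> R by rewrite ltr0n.
have k1 : 1 <= k%:R :> R by rewrite ler1n.
have uw2 : `|u + w| <= 2 by rewrite (le_trans (ler_normD _ _))// u1 w1.
have : k%:R * `|u + w| - (k%:R - 1) <= `|u + k%:R *: w|.
  have -> : u + k%:R *: w = k%:R *: (u + w) - (k%:R - 1) *: u.
    by rewrite scalerDr scalerBl scale1r opprB addrCA [k%:R *: u + _]addrC addrK.
  apply: le_trans (lerB_dist _ _); rewrite !normrZ u1 mulr1 !ger0_norm; lra.
move=> H; rewrite -(ler_pM2l kp) [leLHS]mulrBr mulr1 mulVKf ?gt_eqF// -natr1.
have : k%:R * (2 - `|u + w|) >= 1 * (2 - `|u + w|) by rewrite ler_wpM2r//; lra.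
lra.
Qed.

Lemma Ddet_config_lt (f : {linear X -> R^o}) (kappa eps : R)
    (F : 'I_k -> {linear Z -> R^o}) u w : 0 < kappa -> 0 < eps ->
  (forall j i x, F j (e i x) = (if i == j then kappa * f x else 0) :> R) ->
  (`|Ddet (config e u w) F| < (kappa * eps) ^+ k) -> `|f (u - w) : R| < eps.
Proof.
move=> kap0 eps0 FE; rewrite (Ddet_config _ _ FE) normrX normrM (gtr0_norm kap0).
apply: contraTT; rewrite -!leNgt => le; apply: lerXn2r; rewrite ?nnegrE ?mulr_ge0
  ?(ltW kap0) ?(ltW eps0)//.
by rewrite ler_pM2l.
Qed.

Hypothesis k0 : (0 < k)%N.

Lemma unit_pair_rotund_of_kWUR : kWUR k Z -> unit_pair_rotund 0 0 X.
Proof.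
move=> W f z eps fS eps0.
have [kap kap0 [F [FS FE]]] := proj2 eE f fS.
have e0 : 0 < (kap * eps) ^+ k by rewrite exprn_gt0// mulr_gt0.
have /inf_with1_gt0[d d0 Hd] := W _ F e0 FS.
exists d => // u v u1 v1 uv _; apply: (Ddet_config_lt kap0 eps0 FE).
rewrite ltNge; apply/negP => big.
have : d <= 1 - k.+1%:R^-1 * `|\sum_i config e u v i|.
  by apply: Hd; exists (config e u v) => //; split => // i; exact: norm_config.
move=> /le_trans/(_ (norm_config_sum_ge k0 u1 v1)); lra.
Qed.

Lemma unit_pair_rotund_of_kWLUR : kWLUR k Z -> unit_pair_rotund 1 0 X.
Proof.
move=> W f z eps fS eps0.
(* Off the sphere the claim is vacuous: no unit vector lies closer to [z] than the distance of [|z|]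
   from [1]. *)
have [z1|z1] := eqVneq `|z| 1; last first.
  exists `| `|z| - 1 |; first by rewrite normr_gt0 subr_eq0.
  move=> u v u1 _ _; rewrite scale1r scale0r addr0 -u1 distrC ltNge.
  by rewrite ler_dist_dist.
have [kap kap0 [F [FS FE]]] := proj2 eE f fS.
have e2 : 0 < eps / 2 by rewrite divr_gt0.
have e0 : 0 < (kap * (eps / 2)) ^+ k by rewrite exprn_gt0// mulr_gt0.
have Z1 : unit_sphere (\sum_j e j z) by rewrite /unit_sphere/= norm_blocks.
have /inf_with1_gt0[d d0 Hd] := W _ _ F Z1 e0 FS.
exists (Num.min (d / 2) (eps / 2)); first by rewrite lt_min !divr_gt0.
move=> u v u1 v1 uv; rewrite scale1r scale0r addr0 lt_min => /andP[uzd uze].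
have {}uv : 2 - d / 2 < `|u + v|.
  by apply: le_lt_trans uv; rewrite lerD2l lerN2 ge_min lexx.
(* The configuration is built from [v] and [z], with the blocks of [z] as base point; then
   [f (u - z)] is small because [u] is near [z]. *)
have fvz : `|f (v - z) : R| < eps / 2.
  apply: (Ddet_config_lt kap0 e2 FE); rewrite ltNge; apply/negP => big.
  have : d <= 1 - k.+1%:R^-1 * `|\sum_i config e v z i|.
    apply: Hd; exists (fun i => config e v z (lift ord0 i)).
      by split => [i|] /=; [exact: norm_config|rewrite ord_cons_config].
    by rewrite big_ord_recl config0.
  move=> /le_trans/(_ (norm_config_sum_ge k0 v1 z1)).
  have : `|u + v| <= `|v + z| + `|u - z|.
    apply: le_trans (ler_normD _ _).
    by rewrite addrCA addrK.
  lra.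
have -> : u - v = (u - z) - (v - z) by rewrite opprB addrA subrK.
apply: le_lt_trans (functional_normB _ _ _) _.
rewrite [ltRHS]splitr ltrD//; exact: le_lt_trans (dual_unit_sphere_le _ fS) uze.
Qed.

(** Turns the sequential notion into a uniform one: counterexamples for [d = 1 / (n + 1)] would form
    sequences violating it. *)
Lemma kWMLUR_config : kWMLUR k Z ->
  forall (f : {linear X -> R^o}) (z : X) (eps : R), dual_unit_sphere f ->
    `|z| = 1 -> 0 < eps -> exists2 d : R, 0 < d & forall u w : X,
      `|u| = 1 -> `|w| = 1 -> `|k.+1%:R *: z - (u + k%:R *: w)| < d ->
      `|f (u - w) : R| < eps.
Proof.
move=> W f z eps fS z1 eps0; apply: contrapT => no.
have [kap kap0 [F [FS FE]]] := proj2 eE f fS.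
have /choice[s Hs] (n : nat) : exists s : X * X, [/\ `|s.1| = 1, `|s.2| = 1,
    `|k.+1%:R *: z - (s.1 + k%:R *: s.2)| < n.+1%:R^-1 & eps <= `|f (s.1 - s.2) : R|].
  apply: contrapT => no2; apply: no; exists n.+1%:R^-1; first by rewrite invr_gt0 ltr0n.
  move=> u w u1 w1 uw; rewrite ltNge; apply/negP => big.
  by apply: no2; exists (u, w).
have e0 : 0 < (kap * eps) ^+ k by rewrite exprn_gt0// mulr_gt0.
have Z1 : unit_sphere (\sum_j e j z) by rewrite /unit_sphere/= norm_blocks.
have H1 i n : unit_sphere (config e (s n).1 (s n).2 i).
  by have [a b _ _] := Hs n; exact: norm_config.
have H2 : `|k.+1%:R *: (\sum_j e j z) - \sum_i config e (s n).1 (s n).2 i|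
    @[n --> \oo] --> (0 : R).
  apply/cvgrPdist_lt => r r0.
  have := @near_infty_natSinv_lt R (PosNum r0); apply: filterS => n /= nr.
  rewrite sub0r normrN normr_id; apply: lt_trans nr.
  have [_ _ lt _] := Hs n; apply: le_lt_trans lt.
  rewrite sum_config scaler_sumr -sumrB -[leRHS]norm_blocks.
  by under eq_bigr do rewrite -linearZ -linearB.
have /cvgrPdist_lt/(_ _ e0)/filter_ex[n] :=
  W _ (fun i n => config e (s n).1 (s n).2 i) Z1 H1 H2 F FS.
rewrite sub0r normrN.
move=> /(Ddet_config_lt kap0 eps0 FE); have [_ _ _ big] := Hs n.
by rewrite ltNge big.
Qed.

(** From [u + v] near [2 z] one needs a unit [w] with [u + k w] near [(k + 1) z]. The exact solution
    [w0] has norm between [1] and [1 + d], so normalising it costs at most [d], and [k (u - w0)] is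
    [(k + 1) / 2] times [u - v], up to the residual [r]. *)
Lemma unit_pair_rotund_of_kWMLUR : kWMLUR k Z -> unit_pair_rotund 1 1 X.
Proof.
move=> W f z eps fS eps0.
(* Vacuous off the sphere: [u + v] would have norm near [2] and lie near [2 z] at once. *)
have [z1|z1] := eqVneq `|z| 1; last first.
  exists `| `|z| - 1 |; first by rewrite normr_gt0 subr_eq0.
  move=> u v u1 v1 h1; rewrite !scale1r addrACA -opprD -mulr2n -[z *+ 2]scaler_nat.
  move/(le_lt_trans (ler_dist_dist _ _)); rewrite normrZ ger0_norm// ltr_norml.
  have := ler_normD u v; rewrite u1 v1 => h2 /andP[h3 h4].
  by move: h1 h3 h4; case: (ger0P (`|z| - 1)) => s h1 h3 h4; lra.
have k1 : 1 <= k%:R :> R by rewrite ler1n.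
have e4 : 0 < eps / 4 by rewrite divr_gt0.
have [d0 d00 Hd] := kWMLUR_config W fS z1 e4.
pose d := Num.min (d0 / k.+1%:R) (eps / 8).
have dd0 : d <= d0 / k.+1%:R by rewrite ge_min lexx.
have de : d <= eps / 8 by rewrite ge_min lexx orbT.
have dp : 0 < d by rewrite lt_min !divr_gt0//; lra.
exists d => // u v u1 v1 _; rewrite !scale1r addrACA -opprD -mulr2n -[z *+ 2]scaler_nat => hz.
pose r := 2 *: z - (u + v).
have rd : `|r| < d by rewrite distrC.
pose w0 := k%:R^-1 *: (k.+1%:R *: z - u).
have kw0 : k%:R *: w0 = k.+1%:R *: z - u.
  by rewrite scalerA mulfV ?scale1r// gt_eqF//; lra.
clearbody w0; pose w := `|w0|^-1 *: w0.
have zE : k.+1%:R *: z = (k.+1%:R / 2) *: (u + v + r).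
  by rewrite addrC subrK scalerA divfK.
have kw0E : k%:R *: w0 = ((k%:R - 1) / 2) *: u + (k.+1%:R / 2) *: v + (k.+1%:R / 2) *: r.
  rewrite kw0 zE !scalerDr -natr1 addrAC [X in X + _ = _]addrAC; congr (_ + _ + _).
  by rewrite -[X in _ - X]scale1r -scalerBl; congr (_ *: _); lra.
have lo : 1 <= `|w0|.
  have : k%:R * 1 <= k%:R * `|w0|.
    rewrite -[k%:R in leRHS]ger0_norm ?ler0n// -normrZ kw0.
    apply: le_trans (lerB_dist _ _); rewrite normrZ z1 u1 ger0_norm// -natr1; lra.
  rewrite ler_pM2l//; lra.
have up : `|w0| <= 1 + d.
  have : k%:R * `|w0| <= k%:R * (1 + d).
    rewrite -[k%:R in leLHS]ger0_norm ?ler0n// -normrZ kw0E.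
    apply: le_trans (ler_normD _ _) _; apply: le_trans (lerD (ler_normD _ _) (lexx _)) _.
    rewrite !normrZ u1 v1 !ger0_norm ?divr_ge0//; [|lra].
    have : k.+1%:R / 2 * `|r| <= k%:R * d.
      by apply: ler_pM; rewrite ?divr_ge0 ?(ltW rd)// -natr1; lra.
    rewrite -natr1; lra.
  by rewrite ler_pM2l//; lra.
have w0n : 0 < `|w0| by lra.
have w1 : `|w| = 1 by rewrite normrZ normfV normr_id mulVf// gt_eqF.
have ww : `|w0 - w| <= d.
  have -> : w0 - w = (`|w0| - 1) *: w.
    by rewrite scalerBl scale1r /w scalerA mulfV ?scale1r// gt_eqF.
  rewrite normrZ w1 mulr1 ger0_norm; lra.
have fuw : `|f (u - w) : R| < eps / 4.
  apply: Hd => //; rewrite opprD addrA -kw0 -scalerBr normrZ ger0_norm ?ler0n//.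
  apply: le_lt_trans (_ : k%:R * d < _); first by rewrite ler_wpM2l.
  by move: dd0; rewrite ler_pdivlMr ?ltr0n// mulrC -natr1; lra.
pose c : R := k.+1%:R / 2.
have key : c *: (u - v) = k%:R *: (u - w) + k%:R *: (w - w0) + c *: r.
  have -> : k%:R *: (u - w) + k%:R *: (w - w0) = k%:R *: u - k%:R *: w0.
    by rewrite -scalerDr addrA subrK scalerBr.
  rewrite kw0E -/c opprD addrA subrK opprD addrA -scalerBl scalerBr.
  by congr (_ *: _ - _); rewrite /c -natr1; lra.
have fkey : c * f (u - v) = k%:R * f (u - w) + k%:R * f (w - w0) + c * f r :> R.
  have fZ (a : R) x : a * f x = f (a *: x) by rewrite linearZ.
  by rewrite !fZ key !linearD.
have fww : `|f (w - w0) : R| <= eps / 8.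
  apply: le_trans (dual_unit_sphere_le _ fS) _; rewrite distrC; exact: le_trans ww de.
have fr : `|f r : R| <= eps / 8.
  apply: le_trans (dual_unit_sphere_le _ fS) _; exact/ltW/(lt_le_trans rd de).
(* After division by [c] the three error terms are bounded by [eps / 2], [eps / 4] and [eps / 8]. *)
have kc : k%:R <= 2 * c by rewrite /c -[k.+1%:R]natr1; lra.
have c0 : 0 < c by rewrite divr_gt0// ltr0n.
clearbody c.
rewrite -(ltr_pM2l c0) -{1}(gtr0_norm c0) -normrM fkey.
apply: le_lt_trans (ler_normD _ _) _.
apply: le_lt_trans (lerD (ler_normD _ _) (lexx _)) _.
rewrite !normrM (gtr0_norm c0) ger0_norm ?ler0n//.
have : k%:R * `|f (u - w) : R| <= 2 * c * (eps / 4).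
  by rewrite ler_pM// ltW.
have : k%:R * `|f (w - w0) : R| <= 2 * c * (eps / 8) by rewrite ler_pM.
have : c * `|f r : R| <= c * (eps / 8) by rewrite ler_pM2l.
have : 0 < c * eps by rewrite mulr_gt0.
lra.
Qed.

End Config.

End Blocks.

(** Makes the converse results at [k = 1] extract pair rotundity of a space from its own WUR, WLUR
    or WMLUR. *)
Lemma id_block_embedding (R : realType) (X : completeNormedModType R) :
  block_embedding (fun _ : 'I_1 => idfun : {linear X -> X}).
Proof.
split=> [x c xc|f fS]; first by rewrite big_ord1; exact: xc.
exists 1 => //; exists (fun=> f); split=> // j i x.
by rewrite (ord1 i) (ord1 j) eqxx mul1r.
Qed.

(** * Blocks inside [lp] *)

Section LpBlocks.
Context {R : realType} {p : R} (p1 : 1 < p) (X : completeNormedModType R).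
Let p0 : 0 < p. Proof. exact: lt_trans p1. Qed.
Local Notation lp := (lpspace (ltW p1) X).

(** The factor is chosen so that [k] blocks of norm [c] add up to a vector of norm [c]. *)
Definition lp_block (k : nat) (j : 'I_k) : {linear X -> lp} :=
  (k%:R `^ (- p^-1)) \*: lp_single p1 j.

Lemma lp_block_embedding (k : nat) : (0 < k)%N ->
  block_embedding (@lp_block k).
Proof.
move=> k0; have kp : 0 < k%:R :> R by rewrite ltr0n.
set a : R := k%:R `^ (- p^-1).
have a0 : 0 < a by exact: powR_gt0.
have ap : a `^ p * k%:R = 1.
  rewrite /a -powRrM mulNr mulVf ?gt_eqF// powR_inv1 ?(ltW kp)//.
  by rewrite mulVf// gt_eqF.
have blockE (x : 'I_k -> X) i :
    (\sum_j lp_block j (x j)) i = if insub i is Some j then a *: x j else 0.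
  have E (j : 'I_k) : lp_block j (x j) i = if i == j then a *: x j else 0.
    rewrite -[LHS]/(a *: (lp_single p1 j (x j) i)) lp_singleE.
    by case: ifP => // _; rewrite scaler0.
  rewrite lp_sum_coord; under eq_bigr do rewrite E.
  case: insubP => [j _ ji|ik].
    rewrite (bigD1 j)//= -ji eqxx big1 ?addr0// => j' jj'.
    by rewrite (inj_eq val_inj) eq_sym (negPf jj').
  rewrite big1// => j _; case: eqP => // ij.
  by move: ik; rewrite ij ltn_ord.
split=> [x c xc|f fS].
  have c0 : 0 <= c by rewrite -(xc (Ordinal k0)).
  have term i : `|(\sum_j lp_block j (x j)) i| `^ p =
      if (i < k)%N then (a * c) `^ p else 0.
    rewrite blockE; case: insubP => [j jk _|/negPf ->].
      by rewrite jk normrZ xc gtr0_norm.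
    by rewrite normr0 powR0// gt_eqF.
  have sumk : \sum_(0 <= i < k) `|(\sum_j lp_block j (x j)) i| `^ p = c `^ p.
    rewrite (eq_big_nat _ _ (F2 := fun=> (a * c) `^ p)) => [|i /andP[_ ik]].
      rewrite sumr_const_nat subn0 -mulr_natr powRM ?(ltW a0)//.
      by rewrite mulrAC ap mul1r.
    by rewrite term ik.
  apply/eqP; rewrite eq_le; apply/andP; split.
    apply: lp_norm_le => // n; rewrite -sumk.
    have [nk|kn] := leqP n k.
      rewrite [leRHS](big_cat_nat (leq0n n) nk) /= lerDl.
      by apply: sumr_ge0 => i _; exact: powR_ge0.
    rewrite (big_cat_nat (leq0n k) (ltnW kn)) /= gerDl.
    by rewrite big_nat big1// => i /andP[ki _]; rewrite term ltnNge ki.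
  have := lp_norm_ge (\sum_j lp_block j (x j)) k; rewrite sumk.
  rewrite leNgt => /negP cp; rewrite leNgt; apply/negP => lt; apply: cp.
  by rewrite gt0_ltr_powR ?nnegrE.
(* Composing [f] with evaluation at [j] keeps dual norm one, since vectors supported at [j] recover
   all values of [f] on the unit ball. *)
exists a => //; exists (fun j => f \o @lp_eval R p p1 X j).
have fc : continuous f by case: fS.
have Fle (j : 'I_k) (w : lp) : `|(f \o @lp_eval R p p1 X j) w : R| <= 1 * `|w|.
  rewrite mul1r; apply: le_trans (dual_unit_sphere_le _ fS) _.
  exact: lp_norm_coord.
split=> [j|j i x].
  have Fc : continuous (f \o @lp_eval R p p1 X j) by exact: linear_continuous_of_bound (Fle j).
  split => //; apply/eqP; rewrite eq_le; apply/andP; split.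
    apply: ge_sup; first by have [] := dual_norm_has_sup Fc.
    by move=> _ [w /= w1 <-]; rewrite (le_trans (Fle j w))// mul1r.
  rewrite -[leLHS](proj2 fS); apply: ge_sup; first by have [] := dual_norm_has_sup fc.
  move=> _ [x /= x1 <-].
  have E : lp_eval j (lp_single p1 j x) = x by rewrite /lp_eval lp_singleE eqxx.
  rewrite -{1}E; apply: (dual_norm_ge (z := lp_single p1 j x) Fc).
  by rewrite norm_lp_single.
rewrite -[LHS]/(f (a *: lp_single p1 i x j)) lp_singleE.
rewrite [_ == _ :> nat]eq_sym (inj_eq val_inj).
by case: ifP => _; rewrite ?scaler0 ?linear0// linearZ.
Qed.

End LpBlocks.

(** * The three cycles of implications *)

Theorem corollary4p9 (R : realType) (X : completeNormedModType R)
    (k : nat) (hk : (0 < k)%N) (p : R) (hp : 1 < p) :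
  [/\ [<-> WUR X; WUR (lpspace (ltW hp) X); kWUR k (lpspace (ltW hp) X)],
      [<-> WLUR X; WLUR (lpspace (ltW hp) X); kWLUR k (lpspace (ltW hp) X)] &
      [<-> WMLUR X; WMLUR (lpspace (ltW hp) X);
           kWMLUR k (lpspace (ltW hp) X)]].
Proof.
have k1 : (0 < 1)%N by [].
have idX := id_block_embedding X.
have idlp := id_block_embedding (lpspace (ltW hp) X).
have lpX := lp_block_embedding hp X hk.
have lift (al be : R) : 0 <= be -> be <= al -> al <= 1 ->
    unit_pair_rotund al be X -> unit_pair_rotund al be (lpspace (ltW hp) X).
  move=> be0 beal al1 G.
  exact: lp_unit_pair_rotund (unit_pair_rotund_homogeneous be0 beal al1 G).
split.
(* Each cycle extracts pair rotundity with a block embedding: the identity of [X] followed by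
   [lift], then the identity of [lp], then the [k] blocks of [X] in [lp]. *)
- tfae.
  + move=> /(unit_pair_rotund_of_kWUR idX k1) G.
    by apply: kWUR_of_pair_rotund => //; exact: lift G.
  + by move=> /(unit_pair_rotund_of_kWUR idlp k1); exact: kWUR_of_pair_rotund.
  + by move=> /(unit_pair_rotund_of_kWUR lpX hk); exact: kWUR_of_pair_rotund.
- tfae.
  + move=> /(unit_pair_rotund_of_kWLUR idX k1) G.
    by apply: kWLUR_of_pair_rotund => //; exact: lift G.
  + by move=> /(unit_pair_rotund_of_kWLUR idlp k1); exact: kWLUR_of_pair_rotund.
  + by move=> /(unit_pair_rotund_of_kWLUR lpX hk); exact: kWLUR_of_pair_rotund.
(* The midpoint notion is recovered from the homogeneous condition, so each implication passes
   through [homog]. *)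
- have homog := @unit_pair_rotund_homogeneous R 1 1.
  tfae.
  + move=> /(unit_pair_rotund_of_kWMLUR idX k1) G.
    by apply: kWMLUR_of_pair_rotund => //; apply: homog => //; exact: lift G.
  + move=> /(unit_pair_rotund_of_kWMLUR idlp k1) G.
    by apply: kWMLUR_of_pair_rotund => //; exact: homog G.
  + move=> /(unit_pair_rotund_of_kWMLUR lpX hk) G.
    by apply: kWMLUR_of_pair_rotund => //; exact: homog G.
Qed.
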